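(* Let $\Lambda_\varepsilon$, $\varepsilon\in E=[0,\epsilon]$, be a family of $c$-dimensional ($c\neq0$) normally hyperbolic invariant manifolds of the ODEs $q'=f_\varepsilon(q)$ in $\mathbb{R}^{2k+c}$, with $(k+c)$-dimensional center-unstable and center-stable manifolds $W^{cu}_{\Lambda_\varepsilon},W^{cs}_{\Lambda_\varepsilon}$ having $C^2$ parameterisations $w^{cu},w^{cs}$ and local coordinates $(x,y,z)\in\mathbb{R}^k\times\mathbb{R}^k\times\mathbb{R}^c$ as described in the context. Let $U\subset\mathbb{R}^k$, $V\subset\mathbb{R}^c$ be open and let $\mathrm{cu},\mathrm{cs}:E\times U\times V\to\mathbb{R}^k\times\mathbb{R}^c$ be $C^2$ functions such that for all $\varepsilon\in E$, $(x,z)\in U\times V$ $$\pi_{(x,z)}w^{cu}(\varepsilon,\mathrm{cu}(\varepsilon,x,z))=(x,z),\qquad \pi_{(x,z)}w^{cs}(\varepsilon,\mathrm{cs}(\varepsilon,x,z))=(x,z).$$ Fix $z^*\in V$ and define $y:E\times U\to\mathbb{R}^k$ by $$y(\varepsilon,x)=\pi_yw^{cu}(\varepsilon,\mathrm{cu}(\varepsilon,x,z^* ))-\pi_yw^{cs}(\varepsilon,\mathrm{cs}(\varepsilon,x,z^* )).$$ Assume that for some splitting $k=k_1+k_2$, $x=(x_1,x_2)$, $y=(y_1,y_2)$ (both in $\mathbb{R}^{k_1}\times\mathbb{R}^{k_2}$), one has: $U=B(p,R)$ for some $R>0$ and $p\in\mathbb{R}^k$ with $y(0,p)=0$; $y_2(0,x)=0$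 for all $x\in U$; and, with $$A_{11}=\frac{\partial y_1}{\partial x_1}(0,p),\quad A_{22}=\frac{\partial^2 y_2}{\partial\varepsilon\partial x_2}(0,p),\quad \Delta_1=\left[\frac{\partial y_1}{\partial x}(E,U)-(A_{11},0)\right],\quad \Delta_2=\left[\frac{\partial^2 y_2}{\partial\varepsilon\partial x}(E,U)-(0,A_{22})\right],$$ the inequalities $$m(A_{11})R>\epsilon\left\|\frac{\partial y_1}{\partial\varepsilon}(E,p)\right\|+\|\Delta_1\|R,\qquad m(A_{22})R>\left\|\frac{\partial y_2}{\partial\varepsilon}(E,p)\right\|+\|\Delta_2\|R$$ hold. Then for any $\varepsilon\in(0,\epsilon]$ the manifolds $W^{cu}_{\Lambda_\varepsilon}$ and $W^{cs}_{\Lambda_\varepsilon}$ intersect transversally.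
   Context: Dynamical setting. $q'=f_\varepsilon(q)$ is a smooth family of ODEs in $\mathbb{R}^n$, $n=2k+c$, with parameter $\varepsilon\in E=[0,\epsilon]$, $\epsilon>0$, and flow $\Phi^\varepsilon_t$. For $\varepsilon=0$ there is a normally hyperbolic invariant manifold $\Lambda_0$ of dimension $c$ with unstable and stable coordinates both of dimension $k$; it survives for all $\varepsilon\in E$ as $\Lambda_\varepsilon$. The sets $W^{cu}_{\Lambda_\varepsilon}=\{q:\lim_{t\to-\infty}\mathrm{dist}(\Phi^\varepsilon_t(q),\Lambda_\varepsilon)=0\}$ and $W^{cs}_{\Lambda_\varepsilon}=\{q:\lim_{t\to+\infty}\mathrm{dist}(\Phi^\varepsilon_t(q),\Lambda_\varepsilon)=0\}$ are $C^2$ manifolds of dimension $k+c$. Let $B_k$ be the unit ball in $\mathbb{R}^k$ and $\Lambda$ a fixed $c$-dimensional manifold modelling all $\Lambda_\varepsilon$ (e.g. $\Lambda=\Lambda_0$). The functions $w^{cu},w^{cs}:E\times B_k\times\Lambda\to\mathbb{R}^n$ are $C^2$ and, for each $\varepsilon$, $w^{cu}(\varepsilon,\cdot)$ and $w^{cs}(\varepsilon,\cdot)$ parameterise (local) pieces of $W^{cu}_{\Lambda_\varepsilon}$ and $W^{cs}_{\Lambda_\varepsilon}$. The parameters in $B_k\times\Lambda$ are denoted $\mathrm{cu}$ and $\mathrm{cs}$, respectively, and locally (in a chart of $\Lambda$) are identified with points of $\mathbb{R}^k\times\mathbb{R}^c$. Local coordinates. Locally in $\mathbb{R}^n$ there are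 coordinates $(x,y,z)\in\mathbb{R}^k\times\mathbb{R}^k\times\mathbb{R}^c$, with projections $\pi_{(x,z)},\pi_y$, such that: (A) every matrix in $[\frac{\partial\pi_{(x,z)}w^{cu}}{\partial\mathrm{cu}}(E\times U')]$ is invertible, and (B) every matrix in $[\frac{\partial\pi_{(x,z)}w^{cs}}{\partial\mathrm{cs}}(E\times S')]$ is invertible, where $U',S'\subset\mathbb{R}^k\times\mathbb{R}^c$ are bounded open sets of parameters (with images in the coordinate region); $U\times V\subset\pi_{(x,z)}w^{cu}(E\times U')\cap\pi_{(x,z)}w^{cs}(E\times S')$, and $\mathrm{cu},\mathrm{cs}$ take values in $U',S'$. Notation. Fix norms on $\mathbb{R}^{k_1},\mathbb{R}^{k_2}$ and put $\|(x_1,x_2)\|=\max(\|x_1\|,\|x_2\|)$; $B(p,R)$ is the open ball in this norm; matrix norms are induced operator norms; $\|S\|=\sup_{s\in S}\|s\|$ for a set $S$. $m(A)=1/\|A^{-1}\|$ if $\det A\ne0$, else $m(A)=0$. $g(E,U)=\{g(\varepsilon,x):\varepsilon\in E,x\in U\}$ and $g(E,p)=\{g(\varepsilon,p):\varepsilon\in E\}$. $[S]$ is an interval enclosure: a product of closed intervals (one for each entry) containing $S$. $(A_{11},0)$ and $(0,A_{22})$ are block matrices of sizes $k_1\times k$ and $k_2\times k$. If $k_1=0$ or $k_2=0$ the corresponding inequality is omitted. *)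

(* Defs.v *)
(* Points of R^n are column vectors ['cV[R]_n], so that Jacobians act on the
   left. *)
From HB Require Import structures.
From mathcomp Require Import all_boot all_order all_algebra.
From mathcomp Require Import all_classical all_reals all_analysis.

Set Implicit Arguments.
Unset Strict Implicit.
Unset Printing Implicit Defensive.

Import Order.TTheory GRing.Theory Num.Theory.
Import numFieldNormedType.Exports.

Local Open Scope classical_set_scope.
Local Open Scope ring_scope.

Section Calculus.
Context {R : realType}.

(* Differentiability is relative to S (points y of S tending to x), so that on
   [0, e0] x U the derivatives in the first variable are one-sided at 0 and e0.
   Used only for finite-dimensional V and for sets S that are contained in the
   closure of their interior, where Dg is uniquely determined on S; on an open
   S this is the usual notion of a C^r map. *)
Fixpoint Cr (r : nat) {V W : normedModType R} (S : set V) (g : V -> W) : Prop :=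
  match r with
  | 0 => {within S, continuous g}
  | r'.+1 => exists Dg : V -> {linear V -> W},
      (forall x, S x -> forall e : R, 0 < e ->
        \forall y \near within S (nbhs x),
          `|g y - g x - Dg x (y - x)| <= e * `|y - x|) /\
      (forall v, Cr r' S (fun x => Dg x v))
  end.

Definition smooth {V W : normedModType R} (S : set V) (g : V -> W) : Prop :=
  forall r, Cr r S g.

Definition jac {m p : nat} (g : 'cV[R]_m -> 'cV[R]_p) (x : 'cV[R]_m)
    : 'M[R]_(p, m) :=
  \matrix_(i, j) ('D_(delta_mx j 0 : 'cV[R]_m) g x) i 0.

(* One-sided at the end points of an interval E. *)
Definition derive_in {V : normedModType R} (E : set R) (g : R -> V) (e : R) : V :=
  lim ((fun h : R => h^-1 *: (g (e + h) - g e)) @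
       within [set h | E (e + h)] 0^').

Definition C2_coordinates {n : nat} (O : set 'cV[R]_n)
    (chi : 'cV[R]_n -> 'cV[R]_n) : Prop :=
  [/\ open O, Cr 2 O chi, open (chi @` O) &
      exists2 chi' : 'cV[R]_n -> 'cV[R]_n,
        Cr 2 (chi @` O) chi' & forall q, O q -> chi' (chi q) = q].

End Calculus.

Section Norms.
Context {R : realType}.

Definition is_norm {p : nat} (N : 'cV[R]_p -> R) : Prop :=
  [/\ forall x y, N (x + y) <= N x + N y,
      forall a x, N (a *: x) = `|a| * N x &
      forall x, N x = 0 -> x = 0].

Definition max_norm {k1 k2 : nat} (N1 : 'cV[R]_k1 -> R) (N2 : 'cV[R]_k2 -> R)
    (x : 'cV[R]_(k1 + k2)) : R :=
  Num.max (N1 (usubmx x)) (N2 (dsubmx x)).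

Definition op_norm {p q : nat} (Nq : 'cV[R]_q -> R) (Np : 'cV[R]_p -> R)
    (A : 'M[R]_(p, q)) : R :=
  sup [set Np (A *m v) | v in [set v | Nq v <= 1]].

Definition co_norm {p : nat} (N : 'cV[R]_p -> R) (A : 'M[R]_p) : R :=
  if A \in unitmx then (op_norm N N (invmx A))^-1 else 0.

(* Only applied to nonempty sets on which N is bounded. *)
Definition set_norm {T : Type} (N : T -> R) (S : set T) : R := sup (N @` S).

Definition interval_mx {p q : nat} (lo hi : 'M[R]_(p, q)) : set 'M[R]_(p, q) :=
  [set M | forall i j, lo i j <= M i j <= hi i j].

Definition encloses {p q : nat} (lo hi : 'M[R]_(p, q)) (S : set 'M[R]_(p, q))
    : Prop :=
  S `<=` interval_mx lo hi.

End Norms.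

Section Manifolds.
Context {R : realType}.

(* The inverse of a chart: a map from an open set of R^d into the manifold. *)
Record lparam (d : nat) (T : Type) := LParam {
  ldom : set 'cV[R]_d;
  lmap :> 'cV[R]_d -> T }.

Definition limage {d : nat} {T : Type} (phi : lparam d T) : set T :=
  phi @` ldom phi.

Definition valid_lparam {d : nat} {T : Type} (M : set T) (phi : lparam d T)
    : Prop :=
  [/\ open (ldom phi), set_inj (ldom phi) phi & limage phi `<=` M].

(* The transition map tau = psi^-1 o phi is C^2 with open domain. *)
Definition C2_transition {d : nat} {T : Type} (phi psi : lparam d T) : Prop :=
  let O := ldom phi `&` phi @^-1` limage psi in
  open O /\
  exists2 tau : 'cV[R]_d -> 'cV[R]_d,
    Cr 2 O tau & forall u, O u -> ldom psi (tau u) /\ psi (tau u) = phi u.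

(* Open sets of the topology on M induced by the atlas A. *)
Definition atlas_open {d : nat} {T : Type} (M : set T) (A : set (lparam d T))
    (O : set T) : Prop :=
  O `<=` M /\ forall phi, A phi -> open (ldom phi `&` phi @^-1` O).

(* C^2 manifold of dimension d with underlying set M; the topology is the one
   induced by the atlas A, required to be Hausdorff and second countable. *)
Definition C2_manifold {d : nat} {T : Type} (M : set T) (A : set (lparam d T))
    : Prop :=
  [/\ (forall phi, A phi -> valid_lparam M phi) /\
      M `<=` \bigcup_(phi in A) limage phi,
      forall phi psi, A phi -> A psi -> C2_transition phi psi,
      forall p q, M p -> M q -> p <> q ->
        exists O1 O2, [/\ atlas_open M A O1, atlas_open M A O2,
                         O1 p, O2 q & O1 `&` O2 = set0] &
      exists B : set (lparam d T),
        [/\ countable B, B `<=` A & M `<=` \bigcup_(phi in B) limage phi]].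

(* Manifold W in R^n whose inclusion is a C^2 immersion.  It need not carry the
   topology of R^n: invariant manifolds may accumulate on themselves. *)
Definition C2_submanifold {d n : nat} (W : set 'cV[R]_n)
    (A : set (lparam d 'cV[R]_n)) : Prop :=
  C2_manifold W A /\
  forall phi, A phi -> Cr 2 (ldom phi) phi /\
    forall u, ldom phi u -> \rank (jac phi u) = d.

(* psi parameterises a piece of (W, A): it belongs to the maximal atlas. *)
Definition parameterises_piece {d : nat} {T : Type} (W : set T)
    (A : set (lparam d T)) (psi : lparam d T) : Prop :=
  valid_lparam W psi /\
  forall phi, A phi -> C2_transition phi psi /\ C2_transition psi phi.

(* T = T_q W for the manifold with atlas A. *)
Definition is_tangent_space {d n : nat} (A : set (lparam d 'cV[R]_n))
    (q : 'cV[R]_n) (T : {vspace 'cV[R]_n}) : Prop :=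
  exists (phi : lparam d 'cV[R]_n) (u : 'cV[R]_d),
    [/\ A phi, ldom phi u, phi u = q &
        T = limg (linfun (mulmx (jac phi u) : 'cV[R]_d -> 'cV[R]_n))].

(* There is a point of intersection at which the tangent spaces span R^n. *)
Definition intersect_transversally {d1 d2 n : nat}
    (W1 : set 'cV[R]_n) (A1 : set (lparam d1 'cV[R]_n))
    (W2 : set 'cV[R]_n) (A2 : set (lparam d2 'cV[R]_n)) : Prop :=
  exists (q : 'cV[R]_n) (T1 T2 : {vspace 'cV[R]_n}),
    [/\ W1 q, W2 q, is_tangent_space A1 q T1, is_tangent_space A2 q T2 &
        (T1 + T2)%VS = fullv].

(* The image of an abstract manifold's atlas under an injection h. *)
Definition push_atlas {d : nat} {T T' : Type} (h : T -> T')
    (A : set (lparam d T)) : set (lparam d T') :=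
  [set LParam (ldom phi) (h \o phi) | phi in A].

End Manifolds.

Section Dynamics.
Context {R : realType}.

Definition is_flow {n : nat} (f : 'cV[R]_n -> 'cV[R]_n)
    (Phi : R -> 'cV[R]_n -> 'cV[R]_n) : Prop :=
  forall q, Phi 0 q = q /\
    forall t : R, is_derive (t : R^o) (1 : R^o) (fun s : R^o => Phi s q) (f (Phi t q)).

Definition Wcu {n : nat} (Phi : R -> 'cV[R]_n -> 'cV[R]_n) (L : set 'cV[R]_n)
    : set 'cV[R]_n :=
  [set q | edist_inf L (Phi t q) @[t --> -oo] --> 0%E].

Definition Wcs {n : nat} (Phi : R -> 'cV[R]_n -> 'cV[R]_n) (L : set 'cV[R]_n)
    : set 'cV[R]_n :=
  [set q | edist_inf L (Phi t q) @[t --> +oo] --> 0%E].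

(* Normally hyperbolic invariant manifold (L, A) of dimension c, with unstable
   and stable bundles Eu, Es of dimension k: on Eu (resp. Es) the expansion
   (resp. contraction) rate au (resp. rs) dominates the rate bu (resp. bs) at
   which vectors tangent to L can grow forward (resp. backward) in time. *)
Definition nhim {n : nat} (k c : nat) (Phi : R -> 'cV[R]_n -> 'cV[R]_n)
    (L : set 'cV[R]_n) (A : set (lparam c 'cV[R]_n)) : Prop :=
  [/\ C2_submanifold L A, (forall t, Phi t @` L = L) &
  exists (Eu Es : 'cV[R]_n -> {vspace 'cV[R]_n}) (C au bu rs bs : R),
    [/\ 0 < C, 0 <= bu < au, 0 <= bs < rs &
    forall q, L q ->
      [/\ \dim (Eu q) = k, \dim (Es q) = k,
          forall T, is_tangent_space A q T ->
            [/\ directv (T + Eu q + Es q), (T + Eu q + Es q)%VS = fullv &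
              forall v, v \in T -> forall t, 0 <= t ->
                `|'d (Phi t) q v| <= C * expR (bu * t) * `|v| /\
                `|'d (Phi (- t)) q v| <= C * expR (bs * t) * `|v| ],
          forall v, v \in Eu q -> forall t,
            'd (Phi t) q v \in Eu (Phi t q) /\
            (t <= 0 -> `|'d (Phi t) q v| <= C * expR (au * t) * `|v|) &
          forall v, v \in Es q -> forall t,
            'd (Phi t) q v \in Es (Phi t q) /\
            (0 <= t -> `|'d (Phi t) q v| <= C * expR (- rs * t) * `|v|) ]]].

End Dynamics.

Section Setting.
Context {R : realType} {k c : nat}.

(* Coordinates (x, y, z) in R^k x R^k x R^c are stored as one vector. *)
Definition pi_xz (q : 'cV[R]_(k + k + c)) : 'cV[R]_(k + c) :=
  col_mx (usubmx (usubmx q)) (dsubmx q).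

Definition pi_y (q : 'cV[R]_(k + k + c)) : 'cV[R]_k := dsubmx (usubmx q).

Definition unit_ball : set 'cV[R]_k := [set a | \sum_i (a i 0) ^+ 2 < 1].

(* w(eps, .) : B_k x Lambda -> R^n read in the chart kappa of Lambda, with the
   parameter (a, b) in B_k x ldom kappa stored as one vector. *)
Definition in_chart {T : Type} {n : nat} (w : 'cV[R]_k -> T -> 'cV[R]_n)
    (kappa : lparam c T) : lparam (k + c) 'cV[R]_n :=
  LParam [set v | unit_ball (usubmx v) /\ ldom kappa (dsubmx v)]
         (fun v => w (usubmx v) (kappa (dsubmx v))).

(* w : E x B_k x Lambda -> R^n is C^2 and w(eps, .) parameterises pieces of the
   manifold (W eps, A eps), Lambda being the manifold with atlas AL. *)
Definition C2_parameterisation {T : Type} {n : nat} (E : set R)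
    (AL : set (lparam c T)) (W : R -> set 'cV[R]_n)
    (A : R -> set (lparam (k + c) 'cV[R]_n))
    (w : R -> 'cV[R]_k -> T -> 'cV[R]_n) : Prop :=
  forall kappa, AL kappa ->
    Cr 2 ((E : set R^o) `*` [set v | unit_ball (usubmx v) /\ ldom kappa (dsubmx v)])
       (fun p : R^o * 'cV[R]_(k + c) => in_chart (w p.1) kappa p.2) /\
    forall e, E e -> parameterises_piece (W e) (A e) (in_chart (w e) kappa).

(* D is a bounded open set of parameters whose image under w lies in the domain
   O of the coordinates chi, and every matrix in some interval enclosure of
   the derivatives of pi_(x,z) w with respect to the parameter is invertible. *)
Definition xz_invertible (E : set R) (O : set 'cV[R]_(k + k + c))
    (chi : 'cV[R]_(k + k + c) -> 'cV[R]_(k + k + c))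
    (w : R -> lparam (k + c) 'cV[R]_(k + k + c)) (D : set 'cV[R]_(k + c))
    : Prop :=
  [/\ open D, bounded_set D,
      forall e, E e -> D `<=` ldom (w e) `&` w e @^-1` O &
      exists lo hi : 'M[R]_(k + c),
        encloses lo hi
          [set J | exists e v,
             [/\ E e, D v & J = jac (fun u => pi_xz (chi (w e u))) v]] /\
        forall J, interval_mx lo hi J -> J \in unitmx].

(* The image of E x D under pi_(x,z) w. *)
Definition xz_image (E : set R)
    (chi : 'cV[R]_(k + k + c) -> 'cV[R]_(k + k + c))
    (w : R -> lparam (k + c) 'cV[R]_(k + k + c)) (D : set 'cV[R]_(k + c))
    : set 'cV[R]_(k + c) :=
  [set s | exists e v, [/\ E e, D v & s = pi_xz (chi (w e v))]].

End Setting.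

(* Main.v *)
Require Import Defs.
From HB Require Import structures.
From mathcomp Require Import all_boot all_order all_algebra.
From mathcomp Require Import all_classical all_reals all_analysis.
From mathcomp Require Import ring lra.

(* Fix eps > 0 and rescale y_2 by 1/eps.  Since y_2(0, .) = 0, the mean value
   theorem in eps, applied to each entry of the derivative of y_2 in x, places
   this derivative divided by eps in the box (0, A_22) + Delta_2; a box is a
   product of intervals, so the rows of a mean value matrix, each taken at its
   own point, still form an element of it.  Hence
   x |-> x - (A_11^-1 y_1, A_22^-1 y_2 / eps) is a contraction of a ball of
   radius < R about p into itself.  Its fixed point x* is a zero of y(eps, .),
   where W^cu and W^cs meet, and the contraction constant < 1 also makes the
   derivative of y(eps, .) injective at x*.  In the coordinates (x, y, z) both
   manifolds are graphs over (x, z); the difference of the tangent vectors over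
   (xi, 0) is (0, Dy xi, 0), and these together with one tangent space span. *)

Set Implicit Arguments.
Unset Strict Implicit.
Unset Printing Implicit Defensive.

Import Order.TTheory GRing.Theory Num.Theory.
Import numFieldNormedType.Exports.

Local Open Scope classical_set_scope.
Local Open Scope ring_scope.

(** * Differentiability relative to a set *)

(** When k_2 > 0 the derivative of y(0, .) is singular at p, because y_2(0, .) vanishes on U; the
    zero p therefore cannot be continued to eps > 0 by the implicit function theorem at eps = 0.
    After the division by eps the bounds are the same for all eps in (0, e0], so one ball serves
    every eps. The strict inequalities leave room for a closed, hence compact, ball inside the open
    ball U. At the end points of E the derivatives in eps are one-sided; the calculus is therefore
    set up for derivatives relative to a set, and ordinary derivatives are recovered at interior
    points. *)

Section FrechetWithin.
Context {R : realType}.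

(** The differentiability clause of [Cr], with the derivative as a bare function instead of a
    bundled linear map: derivatives can then be written as plain expressions, and their linearity is
    supplied separately. *)
Definition fderiv {V W : normedModType R} (S : set V) (g : V -> W) (x : V)
    (L : V -> W) : Prop :=
  forall e : R, 0 < e -> \forall y \near within S (nbhs x),
    `|g y - g x - L (y - x)| <= e * `|y - x|.

Definition bounded_lin {V W : normedModType R} (L : V -> W) : Prop :=
  linear L /\ exists2 K : R, 0 < K & forall v, `|L v| <= K * `|v|.

(* A space with coordinates: linear maps on it are bounded, and a derivative
   applied to a varying vector is a finite sum of scalar times fixed ones. *)
Definition fin_dim (V : normedModType R) : Prop :=
  exists n (b : 'I_n -> V) (co : 'I_n -> V -> R^o),
    (forall i, bounded_lin (co i)) /\ forall v, v = \sum_i co i v *: b i.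

Definition mklin {V W : normedModType R} (L : V -> W) (H : linear L)
  : {linear V -> W} := HB.pack L (GRing.isLinear.Build R V W *:%R L H).

Lemma linB (V W : normedModType R) (L : V -> W) u v :
  linear L -> L (u - v) = L u - L v.
Proof. by move=> lL; exact: (raddfB (mklin lL)). Qed.

Lemma linZ (V W : normedModType R) (L : V -> W) a u :
  linear L -> L (a *: u) = a *: L u.
Proof. move=> lL; have L0 : L 0 = 0 by exact: (raddf0 (mklin lL)).
by have := lL a u 0; rewrite L0 !addr0. Qed.

Lemma lin_sumZ (V W : normedModType R) (L : V -> W) n (a : 'I_n -> R) b :
  linear L -> L (\sum_i a i *: b i) = \sum_i a i *: L (b i).
Proof.
move=> lL; transitivity (\sum_i L (a i *: b i)).
  exact: (raddf_sum (mklin lL)).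
by apply: eq_bigr => i _; exact: linZ.
Qed.

Lemma fin_dim_bounded (V W : normedModType R) (L : V -> W) :
  fin_dim V -> linear L -> bounded_lin L.
Proof.
move=> [n [b [co [cob vE]]]] linL; split => //.
have K_ i : {K : R | 0 < K /\ forall v, `|co i v| <= K * `|v|}.
  by apply: cid; have [_ [K ? ?]] := cob i; exists K.
exists (1 + \sum_i sval (K_ i) * `|L (b i)|).
  rewrite ltr_pwDl// sumr_ge0// => i _.
  by have [K0 _] := svalP (K_ i); rewrite mulr_ge0// ltW.
move=> v; have -> : L v = \sum_i co i v *: L (b i).
  by rewrite {1}(vE v) (lin_sumZ _ _ linL).
rewrite mulrDl mul1r; apply: le_trans (ler_norm_sum _ _ _) _.
rewrite mulr_suml -[leLHS]add0r lerD// ler_sum// => i _.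
rewrite normrZ mulrAC ler_wpM2r//.
by have [_ ] := svalP (K_ i).
Qed.

Lemma fin_dim_R : fin_dim (R^o).
Proof.
exists 1%N, (fun=> 1 : R^o), (fun=> id); split.
  by move=> _; split=> //; exists 1 => // v; rewrite mul1r.
by move=> v; rewrite big_ord1 [_ *: _]mulr1.
Qed.

Lemma mx_norm_coord m n (A : 'M[R]_(m, n)) i j : `|A i j| <= `|A|.
Proof.
rewrite [leRHS]/Num.norm /= mx_normrE; apply/bigmax_geP; right.
by exists (i, j).
Qed.

Lemma mx_norm_le m n (A : 'M[R]_(m, n)) (K : R) :
  0 <= K -> (forall i j, `|A i j| <= K) -> `|A| <= K.
Proof.
move=> K0 AK; rewrite [leLHS]/Num.norm /= mx_normrE.
by apply/bigmax_leP; split=> // -[i j] _; exact: AK.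
Qed.

Lemma fin_dim_cV m : fin_dim 'cV[R]_m.
Proof.
exists m, (fun i => delta_mx i 0), (fun i (v : 'cV[R]_m) => v i 0 : R^o); split.
  move=> i; split; first by move=> a u v; rewrite !mxE.
  by exists 1 => // v; rewrite mul1r mx_norm_coord.
move=> v; rewrite [LHS]matrix_sum_delta; apply: eq_bigr => i _.
by rewrite big_ord1.
Qed.

Lemma prod_norm_fst (V W : normedModType R) (p : V * W) : `|p.1| <= `|p|.
Proof. by rewrite /Num.norm /= le_max lexx. Qed.

Lemma prod_norm_snd (V W : normedModType R) (p : V * W) : `|p.2| <= `|p|.
Proof. by rewrite [leRHS]/Num.norm /= le_max lexx orbT. Qed.

Lemma prod_norm_le (V W : normedModType R) (p : V * W) (K : R) :
  `|p.1| <= K -> `|p.2| <= K -> `|p| <= K.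
Proof. by move=> h1 h2; rewrite [leLHS]/Num.norm /= ge_max h1 h2. Qed.

Lemma bounded_lin_comp (U V W : normedModType R) (f : U -> V) (g : V -> W) :
  bounded_lin f -> bounded_lin g -> bounded_lin (g \o f).
Proof.
move=> [lf [K K0 fK]] [lg [M M0 gM]]; split.
  by move=> a u v /=; rewrite lf lg.
exists (M * K); first exact: mulr_gt0.
move=> v; apply: le_trans (gM _) _; rewrite -mulrA ler_wpM2l//.
exact: ltW.
Qed.

Lemma bounded_lin_fst (V W : normedModType R) : bounded_lin (@fst V W).
Proof. by split=> //; exists 1 => // v; rewrite mul1r prod_norm_fst. Qed.

Lemma bounded_lin_snd (V W : normedModType R) : bounded_lin (@snd V W).
Proof. by split=> //; exists 1 => // v; rewrite mul1r prod_norm_snd. Qed.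

Lemma fin_dim_prod (V W : normedModType R) :
  fin_dim V -> fin_dim W -> fin_dim (V * W)%type.
Proof.
move=> [n [b [co [cob vE]]]] [m [b' [co' [cob' vE']]]].
exists (n + m)%N, (fun i : 'I_(n + m) => match fintype.split i with
  inl i => (b i, 0) | inr j => (0, b' j) end),
  (fun (i : 'I_(n + m)) (v : V * W) => match fintype.split i with
  inl i => co i v.1 | inr j => co' j v.2 end); split.
  move=> i; case: (fintype.split i) => j.
    exact: (bounded_lin_comp (@bounded_lin_fst V W) (cob j)).
  exact: (bounded_lin_comp (@bounded_lin_snd V W) (cob' j)).
move=> [v w]; rewrite big_split_ord /=.
rewrite (eq_bigr (fun i => (co i v *: b i, 0 : W))); last first.
  move=> i _; rewrite -[lshift m i]/(unsplit (inl i)) unsplitK.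
  by rewrite -[RHS]/(co i v *: b i, _) -[in RHS](scaler0 W (co i v)).
rewrite [X in _ + X](eq_bigr (fun i => (0 : V, co' i w *: b' i))); last first.
  move=> i _; rewrite -[rshift n i]/(unsplit (inr i)) unsplitK.
  by rewrite -[in RHS](scaler0 V (co' i w)).
have sum1 k (F : 'I_k -> V) : \sum_i (F i, 0 : W) = (\sum_i F i, 0).
  apply/esym; apply: (big_morph (fun x : V => (x, 0 : W))) => // x y.
  by congr (_, _); rewrite /= addr0.
have sum2 k (F : 'I_k -> W) : \sum_i (0 : V, F i) = (0, \sum_i F i).
  apply/esym; apply: (big_morph (fun x : W => (0 : V, x))) => // x y.
  by congr (_, _); rewrite /= addr0.
rewrite sum1 sum2 -vE -vE'.
by congr (_, _); [rewrite /= addr0|rewrite /= add0r].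
Qed.

Lemma fderiv_bound (V W : normedModType R) (S : set V) (g : V -> W) x L :
  bounded_lin L -> fderiv S g x L ->
  exists2 K : R, 0 < K &
    \forall y \near within S (nbhs x), `|g y - g x| <= K * `|y - x|.
Proof.
move=> [_ [K K0 LK]] /(_ 1 ltr01) gL; exists (1 + K); first exact: addr_gt0.
apply: filterS gL => y /= h; rewrite mulrDl.
rewrite -(subrK (L (y - x)) (g y - g x)).
by apply: le_trans (ler_normD _ _) _; rewrite lerD.
Qed.

Lemma near_norm_le (V : normedModType R) (x : V) (e : R) :
  0 < e -> \forall y \near nbhs x, `|y - x| <= e.
Proof.
move=> e0; near=> y.
rewrite distrC ltW//; near: y; exact: (cvgr_dist_lt (@cvg_id _ x)).
Unshelve. all: by end_near. Qed.

Lemma near_within_norm (V : normedModType R) (S : set V) (x : V) (e : R) :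
  0 < e -> \forall y \near within S (nbhs x), `|y - x| <= e.
Proof. by move=> e0; apply: cvg_within; exact: near_norm_le. Qed.

Lemma lipschitz_continuous_at (V W : normedModType R) (f : V -> W) (K : R) :
  0 < K -> (forall x y, `|f x - f y| <= K * `|x - y|) -> continuous f.
Proof.
move=> K0 fK x; apply/cvgrPdist_le => e e0; near=> y.
apply: le_trans (fK _ _) _; rewrite mulrC -ler_pdivlMr// distrC; near: y.
by apply: near_norm_le; exact: divr_gt0.
Unshelve. all: by end_near. Qed.

Lemma fderiv_cvg (V W : normedModType R) (S : set V) (g : V -> W) x L :
  bounded_lin L -> fderiv S g x L -> g y @[y --> within S (nbhs x)] --> g x.
Proof.
move=> bL /(fderiv_bound bL)[K K0 gK]; apply/cvgrPdist_le => e e0.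
near=> y; rewrite distrC.
apply: (@le_trans _ _ (K * `|y - x|)); first by near: y.
rewrite mulrC -ler_pdivlMr//; near: y; apply: near_within_norm.
exact: divr_gt0.
Unshelve. all: by end_near. Qed.

Lemma fderiv_lin (V W : normedModType R) (S : set V) (L : V -> W) x :
  linear L -> fderiv S L x L.
Proof.
move=> lL e e0; apply: nearW => y.
by rewrite (linB _ _ lL) subrr normr0 mulr_ge0// ltW.
Qed.

Lemma fderiv_cst (V W : normedModType R) (S : set V) (w : W) x :
  fderiv S (cst w) x (cst 0).
Proof.
by move=> e e0; apply: nearW => y; rewrite /cst !subrr normr0 mulr_ge0// ltW.
Qed.

Lemma fderivD (V W : normedModType R) (S : set V) (f g : V -> W) x Df Dg :
  fderiv S f x Df -> fderiv S g x Dg -> fderiv S (f \+ g) x (Df \+ Dg).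
Proof.
move=> hf hg e e0; have e20 : 0 < e / 2 by exact: divr_gt0.
near=> y => /=.
rewrite (_ : _ - _ = (f y - f x - Df (y - x)) + (g y - g x - Dg (y - x))).
  2: by rewrite [in RHS]addrACA -opprD [in RHS]addrACA -opprD.
rewrite [e in e * _]splitr mulrDl.
apply: le_trans (ler_normD _ _) (lerD _ _).
  by near: y; exact: (hf _ e20).
by near: y; exact: (hg _ e20).
Unshelve. all: by end_near. Qed.

Lemma fderiv_pair (V W W' : normedModType R) (S : set V) (f : V -> W)
    (g : V -> W') x Df Dg :
  fderiv S f x Df -> fderiv S g x Dg ->
  fderiv S (fun y => (f y, g y)) x (fun v => (Df v, Dg v)).
Proof.
move=> hf hg e e0; near=> y.
apply: prod_norm_le.
  by near: y; exact: (hf _ e0).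
by near: y; exact: (hg _ e0).
Unshelve. all: by end_near. Qed.

Lemma cvg_within_into (U V : normedModType R) (S : set U) (T : set V)
    (f : U -> V) x :
  (forall y, S y -> T (f y)) -> f y @[y --> within S (nbhs x)] --> f x ->
  f y @[y --> within S (nbhs x)] --> within T (nbhs (f x)).
Proof.
move=> ST fc A TA; have := fc _ TA; rewrite /fmap /= !nbhs_simpl => h.
rewrite /within /= in h *; near=> y => Sy.
by apply: (near h y) => //; exact: ST.
Unshelve. all: by end_near. Qed.

Lemma fderiv_comp (U V W : normedModType R) (S : set U) (T : set V)
    (f : U -> V) (g : V -> W) x Df Dg :
  (forall y, S y -> T (f y)) -> bounded_lin Df -> bounded_lin Dg ->
  fderiv S f x Df -> fderiv T g (f x) Dg -> fderiv S (g \o f) x (Dg \o Df).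
Proof.
move=> ST bDf bDg hf hg e e0.
have fc := fderiv_cvg bDf hf.
have [K K0 fK] := fderiv_bound bDf hf.
have [lDg [M M0 gM]] := bDg.
have fw := cvg_within_into ST fc.
(* The remainder splits into that of g at f y, controlled by |f y - f x| <= K |y - x|, and the image
   under Dg, of norm at most M, of the remainder of f; each gets half of e. *)
have e1 : 0 < e / 2 / K by rewrite !divr_gt0.
have e2 : 0 < e / 2 / M by rewrite !divr_gt0.
have hg' := fw _ (hg _ e1); rewrite /fmap /= nbhs_simpl in hg'.
near=> y.
have h1 : `|g (f y) - g (f x) - Dg (f y - f x)| <= e / 2 / K * `|f y - f x|.
  by near: y.
have h2 : `|f y - f x - Df (y - x)| <= e / 2 / M * `|y - x|.
  by near: y; exact: hf.
have h3 : `|f y - f x| <= K * `|y - x| by near: y.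
have -> : (g \o f) y - (g \o f) x - (Dg \o Df) (y - x) =
  (g (f y) - g (f x) - Dg (f y - f x)) + Dg (f y - f x - Df (y - x)).
  by rewrite /= (linB (f y - f x) _ lDg) addrA subrK.
rewrite [e]splitr mulrDl; apply: le_trans (ler_normD _ _) (lerD _ _).
  apply: (le_trans h1); apply: (@le_trans _ _ (e / 2 / K * (K * `|y - x|))).
    by rewrite ler_pM2l.
  by rewrite mulrA divfK ?gt_eqF.
apply: (le_trans (gM _)).
apply: (@le_trans _ _ (M * (e / 2 / M * `|y - x|))); first by rewrite ler_pM2l.
by rewrite mulrA [M * _]mulrC divfK ?gt_eqF.
Unshelve. all: by end_near. Qed.

(** The remainder of the product rule, with a, b, d for a(y), a(x), Da(y - x) and G, H, D for g(y),
    g(x), Dg(y - x): the remainder of a, a cross term of second order, and the remainder of g. *)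
Lemma scale_sub_expand (W : normedModType R) (a b d : R) (G H D : W) :
  a *: G - b *: H - (d *: H + b *: D) =
  (a - b - d) *: G + d *: (G - H) + b *: (G - H - D).
Proof.
rewrite [(a - b - d) *: G]scalerBl [d *: (G - H)]scalerBr subrKA.
rewrite scalerBl !scalerBr [_ - _ - d *: H]addrAC -[_ - _ - b *: D]addrA.
by rewrite subrKA addrACA -opprD.
Qed.

Lemma fderivZ (V W : normedModType R) (S : set V) (a : V -> R^o) (g : V -> W)
    x Da Dg :
  bounded_lin Da -> bounded_lin Dg ->
  fderiv S a x Da -> fderiv S g x Dg ->
  fderiv S (fun y => a y *: g y) x (fun v => Da v *: g x + a x *: Dg v).
Proof.
move=> bDa bDg ha hg e e0.
have [lDa [K K0 aK]] := bDa.
have [M M0 gM] := fderiv_bound bDg hg.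
have gc := fderiv_cvg bDg hg.
set A := `|a x|; set B := `|g x|.
have A0 : 0 <= A := normr_ge0 _.
have B0 : 0 <= B := normr_ge0 _.
(* One third of e for each of the three terms. Near x one has |g y| <= B + 1, and the added 1 keeps
   the denominators positive; the cross term is quadratic in |y - x|, so it is enough to keep |y -
   x| below e / (3 K M). *)
have e1 : 0 < e / 3 / (B + 1) by rewrite !divr_gt0// ltr_wpDl.
have e2 : 0 < e / 3 / (A + 1) by rewrite !divr_gt0// ltr_wpDl.
have e3 : 0 < e / 3 / K / M by rewrite !divr_gt0.
near=> y.
have h1 : `|a y - a x - Da (y - x)| <= e / 3 / (B + 1) * `|y - x|.
  by near: y; exact: ha.
have h2 : `|g y - g x - Dg (y - x)| <= e / 3 / (A + 1) * `|y - x|.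
  by near: y; exact: hg.
have h3 : `|g y - g x| <= M * `|y - x| by near: y.
have h4 : `|y - x| <= e / 3 / K / M by near: y; exact: near_within_norm.
have h5 : `|g y| <= B + 1.
  rewrite -(subrK (g x) (g y)) addrC.
  apply: le_trans (ler_normD _ _) _; rewrite lerD// distrC.
  by near: y; move/cvgrPdist_le : gc; apply.
rewrite (_ : _ - _ = (a y - a x - Da (y - x)) *: g y
   + Da (y - x) *: (g y - g x) + a x *: (g y - g x - Dg (y - x))); last first.
  exact: scale_sub_expand.
rewrite (_ : e = e / 3 + e / 3 + e / 3); last by field.
rewrite 2!mulrDl.
apply: le_trans (ler_normD _ _) (lerD (le_trans (ler_normD _ _) (lerD _ _)) _).
- rewrite normrZ; apply: le_trans (ler_pM _ _ h1 h5) _ => //.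
  by rewrite mulrAC divfK// gt_eqF// ltr_wpDl.
- rewrite normrZ.
  apply: le_trans (ler_pM _ _ (aK _) h3) _ => //.
  rewrite mulrACA mulrA ler_wpM2r//.
  apply: (@le_trans _ _ (K * M * (e / 3 / K / M))).
    by rewrite ler_pM2l ?mulr_gt0.
  by rewrite mulrC [K * M]mulrC mulrA divfK ?gt_eqF// divfK ?gt_eqF.
- rewrite normrZ -/A.
  apply: (@le_trans _ _ ((A + 1) * `|g y - g x - Dg (y - x)|)).
    by rewrite ler_wpM2r// lerDl.
  apply: le_trans (ler_wpM2l _ h2) _; first by rewrite addr_ge0.
  by rewrite mulrA [(A + 1) * _]mulrC divfK// gt_eqF// ltr_wpDl.
Unshelve. all: by end_near. Qed.

Lemma within_continuousP (V W : normedModType R) (S : set V) (g : V -> W) :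
  {within S, continuous g} <->
  forall x, S x -> g y @[y --> within S (nbhs x)] --> g x.
Proof. by split=> [/subspace_continuousP|h]; [|apply/subspace_continuousP]. Qed.

Lemma CrS (r : nat) (V W : normedModType R) (S : set V) (g : V -> W) :
  Cr r.+1 S g <-> exists Dg : V -> V -> W,
    [/\ forall x, linear (Dg x), forall x, S x -> fderiv S g x (Dg x) &
        forall v, Cr r S (fun x => Dg x v)].
Proof.
split=> [[Dg [h1 h2]]|[Dg [l h1 h2]]].
  by exists (fun x => Dg x); split=> // x; exact: linearP.
by exists (fun x => mklin (l x)).
Qed.

Lemma Cr_eq (r : nat) (V W : normedModType R) (S T : set V) (g h : V -> W) :
  T `<=` S -> {in T, g =1 h} -> Cr r S g -> Cr r T h.
Proof.
elim: r W g h => [|r ih] W g h TS gh.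
  move=> /within_continuousP gc; apply/within_continuousP => x Tx.
  apply/cvgrPdist_le => e e0; have /cvgrPdist_le/(_ e e0) := gc x (TS _ Tx).
  rewrite !near_withinE; apply: filterS => y hy Ty.
  by rewrite -!gh ?inE//; apply: hy; exact: TS.
move=> /CrS[Dg [l h1 h2]]; apply/CrS; exists Dg; split=> //; last first.
  by move=> v; exact: (ih _ _ _ TS _ (h2 v)).
move=> x Tx e e0; have := h1 x (TS _ Tx) e e0.
rewrite !near_withinE; apply: filterS => y hy Ty.
by rewrite -!gh ?inE//; apply: hy; exact: TS.
Qed.

Lemma bounded_lin_continuous (V W : normedModType R) (L : V -> W) :
  bounded_lin L -> continuous L.
Proof.
move=> bL x; have := fderiv_cvg bL (@fderiv_lin V W setT L x bL.1).
apply: cvg_trans; apply: cvg_app => P.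
move=> h; apply: (@filterS _ (nbhs x) _ _ _ _ h) => y; exact.
Qed.

Lemma Cr_cst (r : nat) (V W : normedModType R) (S : set V) (w : W) :
  Cr r S (cst w).
Proof.
elim: r w => [|r ih] w.
  by apply/within_continuousP => x _; exact: cvg_cst.
apply/CrS; exists (fun _ _ => 0); split.
- by move=> x a u v; rewrite scaler0 addr0.
- by move=> x _; exact: fderiv_cst.
- by move=> _; exact: ih.
Qed.

Lemma Cr_lin (r : nat) (V W : normedModType R) (S : set V) (L : V -> W) :
  bounded_lin L -> Cr r S L.
Proof.
move=> bL; case: r => [|r].
  apply/within_continuousP => x _; apply: cvg_within_filter.
  exact: bounded_lin_continuous.
apply/CrS; exists (fun _ => L); split.
- by move=> x; exact: bL.1.
- by move=> x _; exact: fderiv_lin bL.1.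
- by move=> v; exact: Cr_cst.
Qed.

Section FinDimSource.
Variables (V : normedModType R).
Hypothesis fV : fin_dim V.

(** The base case is the continuity of a differentiable map, which needs a bounded derivative; [Cr]
    only makes it linear, and the finite dimension of the source does the rest. *)
Lemma CrW (r : nat) (W : normedModType R) (S : set V) (g : V -> W) :
  Cr r.+1 S g -> Cr r S g.
Proof.
elim: r W g => [|r ih] W g /CrS[Dg [l h1 h2]].
  apply/within_continuousP => x Sx.
  exact: fderiv_cvg (fin_dim_bounded fV (l x)) (h1 _ Sx).
by apply/CrS; exists Dg; split=> // v; exact: ih.
Qed.

Lemma CrD (r : nat) (W : normedModType R) (S : set V) (f g : V -> W) :
  Cr r S f -> Cr r S g -> Cr r S (f \+ g).
Proof.
elim: r W f g => [|r ih] W f g.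
  move=> /within_continuousP cf /within_continuousP cg.
  by apply/within_continuousP => x Sx; apply: cvgD; [exact: cf|exact: cg].
move=> /CrS[Df [lf f1 f2]] /CrS[Dg [lg g1 g2]].
apply/CrS; exists (fun x => Df x \+ Dg x); split.
- by move=> x a u v /=; rewrite lf lg scalerDr addrACA.
- by move=> x Sx; apply: fderivD; [exact: f1|exact: g1].
- by move=> v; exact: ih.
Qed.

Lemma Cr_sum (r : nat) (W : normedModType R) (S : set V) n
    (f : 'I_n -> V -> W) :
  (forall i, Cr r S (f i)) -> Cr r S (fun x => \sum_i f i x).
Proof.
elim: n f => [|n ih] f fr.
  by apply: (Cr_eq _ _ (Cr_cst r S 0)) => // x _; rewrite big_ord0.
have := CrD (ih (fun i => f (widen_ord (leqnSn n) i)) (fun i => fr _))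
            (fr ord_max).
by apply: Cr_eq => // x _; rewrite big_ord_recr.
Qed.

Lemma Cr_linc (r : nat) (W W' : normedModType R) (S : set V) (L : W -> W')
    (g : V -> W) :
  bounded_lin L -> Cr r S g -> Cr r S (L \o g).
Proof.
move=> bL; elim: r g => [|r ih] g.
  move=> /within_continuousP cg; apply/within_continuousP => x Sx.
  have h : L w @[w --> g x] --> L (g x) by exact: bounded_lin_continuous.
  exact: (@cvg_comp _ _ _ g L _ _ _ (cg x Sx) h).
move=> /CrS[Dg [lg g1 g2]]; apply/CrS; exists (fun x => L \o Dg x); split.
- by move=> x a u v /=; rewrite lg bL.1.
- move=> x Sx; apply: (fderiv_comp (T := setT)) => //; last first.
  + exact: fderiv_lin bL.1.
  + exact: g1.
  exact: fin_dim_bounded.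
- by move=> v; exact: (ih (Dg ^~ v)).
Qed.

Lemma CrN (r : nat) (W : normedModType R) (S : set V) (g : V -> W) :
  Cr r S g -> Cr r S (fun x => - g x).
Proof.
apply: (Cr_linc (L := -%R)); split.
  by move=> a u v; rewrite opprD scalerN.
by exists 1 => // v; rewrite normrN mul1r.
Qed.

Lemma Cr_pair (r : nat) (W W' : normedModType R) (S : set V) (f : V -> W)
    (g : V -> W') :
  Cr r S f -> Cr r S g -> Cr r S (fun x => (f x, g x)).
Proof.
elim: r f g => [|r ih] f g.
  move=> /within_continuousP cf /within_continuousP cg.
  by apply/within_continuousP => x Sx; apply: cvg_pair; [exact: cf|exact: cg].
move=> /CrS[Df [lf f1 f2]] /CrS[Dg [lg g1 g2]].
apply/CrS; exists (fun x v => (Df x v, Dg x v)); split.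
- by move=> x a u v; rewrite lf lg.
- by move=> x Sx; apply: fderiv_pair; [exact: f1|exact: g1].
- by move=> v; exact: ih.
Qed.

Lemma CrZ (r : nat) (W : normedModType R) (S : set V) (a : V -> R^o)
    (g : V -> W) :
  Cr r S a -> Cr r S g -> Cr r S (fun x => a x *: g x).
Proof.
elim: r a g => [|r ih] a g.
  move=> /within_continuousP cf /within_continuousP cg.
  by apply/within_continuousP => x Sx; apply: cvgZ; [exact: cf|exact: cg].
move=> ra rg; have [ra' rg'] := (CrW ra, CrW rg).
(* The derivative of the product contains a and g themselves, so their regularity of order r, kept
   in [ra'] and [rg'], is needed next to that of Da and Dg. *)
move: ra rg => /CrS[Da [la a1 a2]] /CrS[Dg [lg g1 g2]].
apply/CrS; exists (fun x v => Da x v *: g x + a x *: Dg x v); split.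
- move=> x c u v; rewrite la lg scalerDl !scalerDr.
  rewrite -[c *: Da x u]/(c * Da x u) !scalerA.
  by rewrite [c * a x]mulrC addrACA.
- by move=> x Sx; apply: fderivZ (a1 x Sx) (g1 x Sx); exact: fin_dim_bounded.
- by move=> v; apply: CrD; exact: ih.
Qed.

End FinDimSource.

Lemma Cr_comp (r : nat) (U V W : normedModType R) (S : set U) (T : set V)
    (f : U -> V) (g : V -> W) :
  fin_dim U -> fin_dim V -> (forall x, S x -> T (f x)) ->
  Cr r S f -> Cr r T g -> Cr r S (g \o f).
Proof.
move=> fU fV ST; elim: r W g f ST => [|r ih] W g f ST.
  move=> /within_continuousP cf /within_continuousP cg.
  apply/within_continuousP => x Sx.
  exact: (cvg_comp _ _ (cvg_within_into ST (cf x Sx)) (cg _ (ST _ Sx))).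
move=> rf; have rf' := CrW fU rf; move: rf.
move=> /CrS[Df [lf f1 f2]] /CrS[Dg [lg g1 g2]].
apply/CrS; exists (fun x => Dg (f x) \o Df x); split.
- by move=> x a u v /=; rewrite lf lg.
- move=> x Sx.
  by apply: (fderiv_comp ST _ _ (f1 x Sx) (g1 _ (ST _ Sx)));
    exact: fin_dim_bounded.
(* Even for fixed v the argument Df x v of Dg (f x) varies with x, whereas [Cr] controls Dg only in
   fixed directions; expanding it in the directions b i reduces the claim to products. *)
move=> v; have [n [b [co [cob vE]]]] := fV.
have : Cr r S (fun x => \sum_i co i (Df x v) *: Dg (f x) (b i)).
  apply: Cr_sum => // i; apply: CrZ => //.
    exact: (Cr_linc fU (cob i) (f2 v)).
  by apply: (ih _ (fun y => Dg y (b i)) f).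
apply: Cr_eq => // x _ /=.
by rewrite [in RHS](vE (Df x v)) (lin_sumZ _ _ (lg _)).
Qed.

End FrechetWithin.

(** * Norms on column vectors *)

Section Norms.
Context {R : realType}.

Section NormFacts.
Variables (p : nat) (N : 'cV[R]_p -> R).
Hypothesis hN : is_norm N.

Lemma nrmD x y : N (x + y) <= N x + N y. Proof. by case: hN. Qed.
Lemma nrmZ a x : N (a *: x) = `|a| * N x. Proof. by case: hN. Qed.
Lemma nrm0_eq0 x : N x = 0 -> x = 0. Proof. by case: hN => _ _; exact. Qed.
Lemma nrm0 : N 0 = 0. Proof. by rewrite -(scale0r 0) nrmZ normr0 mul0r. Qed.
Lemma nrmN x : N (- x) = N x.
Proof. by rewrite -scaleN1r nrmZ normrN normr1 mul1r. Qed.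
Lemma nrmB x y : N (x - y) = N (y - x). Proof. by rewrite -nrmN opprB. Qed.
Lemma nrm_ge0 x : 0 <= N x.
Proof.
have := nrmD x (- x); rewrite subrr nrm0 nrmN -mulr2n => h.
by rewrite -(pmulrn_lge0 _ (ltn0Sn 1)).
Qed.

Lemma nrm_sum n (F : 'I_n -> 'cV[R]_p) : N (\sum_i F i) <= \sum_i N (F i).
Proof.
elim: n F => [|n ih] F; first by rewrite !big_ord0 nrm0.
by rewrite !big_ord_recr /=; apply: le_trans (nrmD _ _) (lerD (ih _) _).
Qed.

Lemma nrm_le_norm : exists2 K : R, 0 < K & forall v, N v <= K * `|v|.
Proof.
exists (1 + \sum_i N (delta_mx i 0)).
  by rewrite ltr_pwDl// sumr_ge0// => i _; exact: nrm_ge0.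
move=> v; rewrite [in leLHS](matrix_sum_delta v) mulrDl mul1r.
apply: le_trans (nrm_sum _) _.
rewrite mulr_suml -[leLHS]add0r lerD// ler_sum// => i _.
rewrite big_ord1 nrmZ mulrC ler_wpM2l ?nrm_ge0//.
exact: mx_norm_coord.
Qed.

Lemma ler_nrm_dist x y : `|N x - N y| <= N (x - y).
Proof.
rewrite ler_norml lerBlDr; apply/andP; split.
  rewrite lerNl opprB lerBlDr nrmB.
  by apply: le_trans (nrmD _ _); rewrite subrK.
by apply: le_trans (nrmD _ _); rewrite subrK.
Qed.

Lemma nrm_continuous : continuous N.
Proof.
have [K K0 NK] := nrm_le_norm.
apply: (lipschitz_continuous_at (W := R^o) K0) => x y.
by apply: le_trans (ler_nrm_dist _ _) _; exact: NK.
Qed.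

End NormFacts.

Lemma cV_bounded_closed_compact p (A : set 'cV[R]_p) :
  bounded_set A -> closed A -> compact A.
Proof.
have norm_tr m n (v : 'M[R]_(m, n)) : `|v^T| <= `|v|.
  by apply: mx_norm_le => // i j; rewrite mxE mx_norm_coord.
have bl m n : bounded_lin (@trmx R m n).
  split; first by move=> a u v; rewrite linearD linearZ.
  by exists 1 => // v; rewrite mul1r; exact: norm_tr.
move=> [M [Mr AM]] cA.
(* Transposition carries the statement over to row vectors. *)
have -> : A = trmx @` (trmx @^-1` A : set 'rV[R]_p).
  apply/seteqP; split=> [v Av|_ [v Av <-]//].
  by exists v^T; rewrite /= ?trmxK.
apply: continuous_compact.
  by apply: continuous_subspaceT; exact: bounded_lin_continuous.
apply: bounded_closed_compact; last first.
  by apply: closed_comp => // x _; exact: bounded_lin_continuous.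
exists M; split => // x Mx v /(AM x Mx) h.
by apply: le_trans h; have := norm_tr _ _ v^T; rewrite trmxK.
Qed.

Section NormCompact.
Variables (p : nat) (N : 'cV[R]_p -> R).
Hypothesis hN : is_norm N.

(** Equivalence of norms: M is the inverse of the minimum of [N] on the unit sphere, positive since
    [N] vanishes only at 0. The sphere is empty when p = 0, which is a case of its own. *)
Lemma norm_le_nrm : exists2 M : R, 0 < M & forall v, `|v| <= M * N v.
Proof.
pose S := [set v : 'cV[R]_p | `|v| = 1].
have cS : compact S.
  apply: cV_bounded_closed_compact.
    by exists 1; split=> // x x1 v; rewrite /S /= => ->; exact: ltW.
  rewrite (_ : S = Num.norm @^-1` [set 1 : R])//.
  apply: closed_comp; last exact: closed_eq.
  by move=> x _; exact: norm_continuous.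
have [S0|/nonemptyPn S0] := pselect (S !=set0); last first.
  exists 1 => // v; have [->|v0] := eqVneq v 0.
    by rewrite normr0 (nrm0 hN) mulr0.
  suff : S (`|v|^-1 *: v) by rewrite S0.
  by rewrite /S /= normrZ normfV normr_id mulVf ?normr_eq0.
have cN := continuous_subspaceT (A := S) (nrm_continuous hN).
have [u uS umin] := compact_EVT_min S0 cS cN.
have Nu : 0 < N u.
  rewrite lt_neqAle (nrm_ge0 hN) andbT eq_sym; apply/eqP => /(nrm0_eq0 hN) u0.
  by move: uS; rewrite inE /S /= u0 normr0 => /esym/eqP; rewrite oner_eq0.
exists (N u)^-1; first by rewrite invr_gt0.
move=> v; have [->|v0] := eqVneq v 0.
  by rewrite normr0 (nrm0 hN) mulr0.
rewrite ler_pdivlMl// -ler_pdivlMr ?normr_gt0//.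
have /umin : (`|v|^-1 *: v) \in S.
  by rewrite inE /S /= normrZ normfV normr_id mulVf ?normr_eq0.
by rewrite (nrmZ hN) normfV normr_id mulrC.
Qed.

Lemma nrm_closed_ball_compact (x : 'cV[R]_p) (r : R) :
  compact [set v | N (v - x) <= r].
Proof.
have [M M0 NM] := norm_le_nrm.
apply: cV_bounded_closed_compact.
  exists (M * r + `|x|); split; first exact: num_real.
  move=> y hy v /= vr.
  apply: le_trans (ltW hy); rewrite -(subrK x v).
  apply: le_trans (ler_normD _ _) _; rewrite lerD// (le_trans (NM _))//.
  by rewrite ler_pM2l.
rewrite (_ : mkset _ = (fun v => N (v - x)) @^-1` [set y | y <= r])//.
apply: closed_comp; last exact: closed_le.
have [K K0 NK] := nrm_le_norm hN.
move=> v _; apply: (lipschitz_continuous_at (W := R^o) K0) => {}v w.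
apply: le_trans (ler_nrm_dist hN _ _) _; apply: le_trans (NK _) _.
by rewrite opprB addrA subrK.
Qed.

(* N (T x - x) attains its minimum on the compact ball, and T would decrease a
   nonzero minimum. *)
Lemma nrm_contraction_fixpoint (T : 'cV[R]_p -> 'cV[R]_p) (x0 : 'cV[R]_p)
    (r l : R) :
  0 <= r -> l < 1 ->
  (forall x, N (x - x0) <= r -> N (T x - x0) <= r) ->
  (forall x x', N (x - x0) <= r -> N (x' - x0) <= r ->
     N (T x - T x') <= l * N (x - x')) ->
  exists2 x, N (x - x0) <= r & T x = x.
Proof.
move=> r0 l1 TK Tl; pose K := [set v | N (v - x0) <= r].
have K0 : K !=set0 by exists x0; rewrite /K /= subrr (nrm0 hN).
have [C C0 NC] := nrm_le_norm hN.
have cf : {within K, continuous (fun x => N (T x - x))}.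
  apply/(within_continuousP (W := R^o)) => x Kx; apply/cvgrPdist_le => e e0.
  (* This makes N (x - y) <= e / 2; as T does not increase distances, T x - T y contributes at most
     another e / 2. *)
  have e1 : 0 < e / (C * 2) by rewrite !divr_gt0// mulr_gt0.
  have := near_within_norm K x e1; rewrite !near_withinE.
  apply: filterS => y hy Ky; have {}hy := hy Ky.
  apply: le_trans (ler_nrm_dist hN _ _) _.
  have -> : T x - x - (T y - y) = (T x - T y) - (x - y).
    by rewrite [in LHS]opprD [in RHS]opprD addrACA.
  apply: le_trans (nrmD hN _ _) _; rewrite (nrmN hN).
  have hxy : N (x - y) <= e / 2.
    apply: le_trans (NC _) _; rewrite distrC.
    apply: (@le_trans _ _ (C * (e / (C * 2)))); first by rewrite ler_pM2l.
    by rewrite le_eqVlt; apply/orP; left; apply/eqP; field; rewrite gt_eqF.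
  rewrite [e]splitr lerD//; apply: le_trans (Tl _ _ Kx Ky) _.
  apply: le_trans hxy; rewrite -[leRHS]mul1r ler_wpM2r ?(nrm_ge0 hN)// ltW//.
have cK : compact (K : set 'cV[R]_p) by exact: nrm_closed_ball_compact.
have [x xK xmin] := compact_EVT_min K0 cK cf.
move: xK; rewrite inE => Kx; exists x => //.
apply/eqP; rewrite -subr_eq0; apply/eqP/(nrm0_eq0 hN)/eqP.
apply: contraT => d0.
have dgt : 0 < N (T x - x) by rewrite lt_neqAle eq_sym d0 (nrm_ge0 hN).
have KT : K (T x) by exact: TK.
have := xmin (T x); rewrite inE => /(_ KT).
rewrite leNgt; suff -> : N (T (T x) - T x) < N (T x - x) by [].
apply: le_lt_trans (Tl _ _ KT Kx) _.
by rewrite -[ltRHS]mul1r ltr_pM2r.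
Qed.

(** Since [N] is an arbitrary norm, the inequality is proved directly. With the slope relaxed to M +
    e, the set A of points where the estimate holds contains its supremum c, and differentiability
    at c produces a larger element of A unless c = b. *)
Lemma nrm_mean_value (g : R^o -> 'cV[R]_p) (g' : R -> 'cV[R]_p) (a b M : R) :
  a <= b ->
  (forall s, a <= s <= b ->
    fderiv [set x | a <= x <= b] g s (fun h => h *: g' s)) ->
  (forall s, a <= s <= b -> N (g' s) <= M) ->
  N (g b - g a) <= M * (b - a).
Proof.
move=> ab dg gM; have [K K0 NK] := nrm_le_norm hN.
suff H e : 0 < e -> N (g b - g a) <= (M + e) * (b - a).
  apply/ler_addgt0Pr => e e0.
  have d0 : 0 < b - a + 1 by rewrite ltr_wpDl// subr_ge0.
  apply: le_trans (H (e / (b - a + 1)) (divr_gt0 e0 d0)) _.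
  rewrite mulrDl lerD2l mulrAC ler_pdivrMr// ler_pM2l// lerDl//.
move=> e0.
pose A := [set t | a <= t <= b /\ N (g t - g a) <= (M + e) * (t - a)].
have Aa : A a by rewrite /A /= lexx ab !subrr mulr0 (nrm0 hN).
have sA : has_sup A by split; [exists a|exists b => t [/andP[]]].
have Ale t : A t -> t <= sup A by move=> At; apply: sup_upper_bound.
pose c := sup A.
have ac : a <= c by exact: Ale.
have cb : c <= b by apply: ge_sup; [exists a|move=> t [/andP[]]].
(* Differentiability at c with tolerance e / K, where K converts the norm of the space into [N]. *)
have [d d0 hd] : exists2 d : R, 0 < d & forall t, a <= t <= b -> `|t - c| < d ->
    N (g t - g c) <= (M + e) * `|t - c|.
  have acb : a <= c <= b by rewrite ac cb.
  have := dg _ acb _ (divr_gt0 e0 K0).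
  rewrite near_withinE => /nbhs_ballP[d /= d0 hd]; exists d => // t tab td.
  have hb : ball (c : R^o) d t by rewrite -ball_normE /ball_ /= distrC.
  have {}hd := hd t hb tab.
  rewrite -(subrK ((t - c) *: g' c) (g t - g c)).
  apply: le_trans (nrmD hN _ _) _; rewrite (nrmZ hN) mulrDl addrC lerD//.
    by rewrite mulrC ler_wpM2r// gM.
  apply: le_trans (NK _) _.
  apply: (@le_trans _ _ (K * (e / K * `|t - c|))).
    by rewrite ler_pM2l.
  by rewrite mulrA [K * _]mulrC divfK ?gt_eqF.
(* Some t in A lies within d of its supremum c, and the local estimate between t and c is added to
   the one between a and t. *)
have Ac : A c.
  split; first by rewrite ac cb.
  have [t At ct] := sup_adherent d0 sA.
  have tc := Ale _ At.
  have [tab tN] := At.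
  rewrite -(subrKA (g t)); apply: le_trans (nrmD hN _ _) _.
  have : N (g c - g t) <= (M + e) * (c - t).
    rewrite (nrmB hN); apply: le_trans (hd _ tab _) _.
      by rewrite distrC ger0_norm ?subr_ge0// ltrBlDl -ltrBlDr.
    by rewrite distrC ger0_norm ?subr_ge0.
  move=> h; apply: le_trans (lerD h tN) _.
  by rewrite -mulrDr addrA subrK.
have [cb'|bc] := ltP c b; last first.
  have -> : b = c by apply/eqP; rewrite eq_le bc cb.
  by case: Ac.
(* Half of d, because the local estimate at c asks for a distance strictly below d. *)
pose t := Num.min b (c + d / 2).
have ct : c < t by rewrite lt_min cb' ltrDl divr_gt0.
suff /Ale : A t by rewrite leNgt ct.
have tab : a <= t <= b by rewrite (le_trans ac (ltW ct)) ge_min lexx.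
split=> //; rewrite -(subrKA (g c)); apply: le_trans (nrmD hN _ _) _.
have tc0 : 0 <= t - c by rewrite subr_ge0 ltW.
have h : N (g t - g c) <= (M + e) * (t - c).
  apply: le_trans (hd _ tab _) _; last by rewrite ger0_norm.
  rewrite ger0_norm// ltrBlDl; apply: (@le_lt_trans _ _ (c + d / 2)).
    by rewrite ge_min lexx orbT.
  by rewrite ltrD2l ltr_pdivrMr// ltr_pMr// ltrDl.
case: Ac => _ hc; apply: le_trans (lerD h hc) _.
by rewrite -mulrDr addrA subrK.
Qed.

End NormCompact.
End Norms.

(** * Operator norms and a Newton-like iteration *)

Section OperatorNorms.
Context {R : realType}.

Lemma mulmx_norm_le p q (A : 'M[R]_(p, q)) (v : 'cV[R]_q) :
  `|A *m v| <= q%:R * `|A| * `|v|.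
Proof.
apply: mx_norm_le => [|i j]; first by rewrite !mulr_ge0.
rewrite mxE; apply: le_trans (ler_norm_sum _ _ _) _.
apply: (@le_trans _ _ (\sum_(k < q) `|A| * `|v|)).
  by apply: ler_sum => k _; rewrite normrM ler_pM// mx_norm_coord.
by rewrite sumr_const card_ord -mulrA mulr_natl.
Qed.

Section OpNorm.
Variables (p q : nat) (Nq : 'cV[R]_q -> R) (Np : 'cV[R]_p -> R).
Hypotheses (hq : is_norm Nq) (hp : is_norm Np).

(** The constant is independent of A: this gives both the finiteness of each operator norm and its
    boundedness on a box of matrices. *)
Lemma op_norm_unif_bound : exists2 C : R, 0 < C &
  forall (A : 'M[R]_(p, q)) v, Np (A *m v) <= C * `|A| * Nq v.
Proof.
have [K K0 NK] := nrm_le_norm hp; have [M M0 NM] := norm_le_nrm hq.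
(* The summand 1 keeps the constant positive when q = 0. *)
exists (K * (1 + q%:R) * M); first by rewrite !mulr_gt0// ltr_pwDl.
move=> A v; apply: le_trans (NK _) _.
have -> : K * (1 + q%:R) * M * `|A| * Nq v =
  K * ((1 + q%:R) * `|A| * (M * Nq v)) by ring.
rewrite ler_pM2l//; apply: le_trans (mulmx_norm_le _ _) _.
by rewrite ler_pM ?mulr_ge0// ler_wpM2r// lerDr.
Qed.

Lemma op_norm_has_sup (A : 'M[R]_(p, q)) :
  has_sup [set Np (A *m v) | v in [set v | Nq v <= 1]].
Proof.
have [C C0 h] := op_norm_unif_bound; split.
  by exists (Np (A *m 0)), 0 => //=; rewrite (nrm0 hq).
exists (C * `|A|) => _ [v /= v1 <-]; apply: le_trans (h _ _) _.
by rewrite ler_piMr// mulr_ge0// ltW.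
Qed.

Lemma op_norm_ge0 (A : 'M[R]_(p, q)) : 0 <= op_norm Nq Np A.
Proof.
apply: (@le_trans _ _ (Np (A *m 0))); first exact: nrm_ge0.
apply: sup_upper_bound; first exact: op_norm_has_sup.
by exists 0 => //=; rewrite (nrm0 hq).
Qed.

Lemma op_norm_le (A : 'M[R]_(p, q)) v : Np (A *m v) <= op_norm Nq Np A * Nq v.
Proof.
have [v0|v0] := eqVneq (Nq v) 0.
  by rewrite (nrm0_eq0 hq v0) mulmx0 (nrm0 hp) (nrm0 hq) mulr0.
have v1 : 0 < Nq v by rewrite lt_neqAle eq_sym v0 (nrm_ge0 hq).
rewrite -ler_pdivrMr//; apply: sup_upper_bound; first exact: op_norm_has_sup.
exists ((Nq v)^-1 *: v) => /=.
  by rewrite (nrmZ hq) ger0_norm ?invr_ge0 ?(nrm_ge0 hq)// mulVf.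
by rewrite -scalemxAr (nrmZ hp) ger0_norm ?invr_ge0 ?(nrm_ge0 hq)// mulrC.
Qed.

Lemma op_norm_bound : exists2 C : R, 0 < C &
  forall A : 'M[R]_(p, q), op_norm Nq Np A <= C * `|A|.
Proof.
have [C C0 h] := op_norm_unif_bound; exists C => // A.
apply: ge_sup; first by case: (op_norm_has_sup A).
move=> _ [v /= v1 <-]; apply: le_trans (h _ _) _.
by rewrite ler_piMr// mulr_ge0// ltW.
Qed.

Lemma set_norm_ge0 (T : Type) (F : T -> R) (S : set T) :
  (forall t, 0 <= F t) -> 0 <= set_norm F S.
Proof.
(* On a set without supremum [sup] takes the value 0. *)
move=> F0; have [h|h] := pselect (has_sup (F @` S)); last first.
  by rewrite /set_norm sup_out.
have [[y [t St _]] _] := h.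
by apply: le_trans (F0 t) _; apply: sup_upper_bound => //; exists t.
Qed.

Lemma set_norm_interval_le (lo hi A : 'M[R]_(p, q)) :
  interval_mx lo hi A ->
  op_norm Nq Np A <= set_norm (op_norm Nq Np) (interval_mx lo hi).
Proof.
move=> hA; have [C C0 h] := op_norm_bound.
apply: sup_upper_bound; last by exists A.
split; first by exists (op_norm Nq Np A), A.
(* A real [sup] bounds its set only if the set is bounded above; the entries of a matrix in the box
   are at most |lo| + |hi| in absolute value. *)
exists (C * (`|lo| + `|hi|)) => _ [B hB <-].
apply: le_trans (h B) _; rewrite ler_pM2l//.
apply: mx_norm_le => [|i j]; first by rewrite addr_ge0.
have /andP[l1 l2] := hB i j.
have /ler_normlP[h1 h2] := mx_norm_coord lo i j.
have /ler_normlP[h3 h4] := mx_norm_coord hi i j.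
have n1 : 0 <= `|lo| := normr_ge0 _.
have n2 : 0 <= `|hi| := normr_ge0 _.
by apply/ler_normlP; split; lra.
Qed.

End OpNorm.

(** Singular matrices have [co_norm] 0, so positivity gives invertibility; this is how the
    hypotheses yield the inverses of A_11 and A_22. *)
Lemma co_norm_gt0 p (N : 'cV[R]_p -> R) (A : 'M[R]_p) :
  is_norm N -> 0 < co_norm N A ->
  A \in unitmx /\ forall v, N (invmx A *m v) <= (co_norm N A)^-1 * N v.
Proof.
rewrite /co_norm => hN; case: ifP; last by rewrite ltxx.
by move=> uA _; split=> // v; rewrite invrK; exact: op_norm_le.
Qed.

Lemma max_norm_is_norm k1 k2 (N1 : 'cV[R]_k1 -> R) (N2 : 'cV[R]_k2 -> R) :
  is_norm N1 -> is_norm N2 -> is_norm (max_norm N1 N2).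
Proof.
move=> h1 h2; split.
- move=> x y; rewrite /max_norm !linearD /= ge_max; apply/andP; split.
    by apply: le_trans (nrmD h1 _ _) (lerD _ _); rewrite le_max lexx.
  by apply: le_trans (nrmD h2 _ _) (lerD _ _); rewrite le_max lexx orbT.
- move=> a x; rewrite /max_norm !linearZ /= (nrmZ h1) (nrmZ h2).
  by rewrite maxr_pMr.
- move=> x x0; rewrite -[x]vsubmxK.
  have m0 : N1 (usubmx x) <= 0 /\ N2 (dsubmx x) <= 0.
    by rewrite -x0 /max_norm !le_max !lexx orbT.
  have -> : usubmx x = 0.
    by apply: (nrm0_eq0 h1); apply/eqP; rewrite eq_le m0.1 (nrm_ge0 h1).
  have -> : dsubmx x = 0.
    by apply: (nrm0_eq0 h2); apply/eqP; rewrite eq_le m0.2 (nrm_ge0 h2).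
  by rewrite col_mx0.
Qed.

Lemma nrm_dim0 p (N : 'cV[R]_p -> R) v : is_norm N -> (p = 0)%N -> N v = 0.
Proof.
move=> hN p0; rewrite (_ : v = 0) ?(nrm0 hN)//.
by apply/colP => i; exfalso; move: (ltn_ord i); rewrite {2}p0.
Qed.

Lemma usubmxB m n (x y : 'cV[R]_(m + n)) :
  usubmx (x - y) = usubmx x - usubmx y.
Proof. exact: linearB. Qed.

Lemma dsubmxB m n (x y : 'cV[R]_(m + n)) :
  dsubmx (x - y) = dsubmx x - dsubmx y.
Proof. exact: linearB. Qed.

Lemma subrB_swap (Z : zmodType) (a b c d : Z) :
  a - b - (c - d) = - (b - d - (a - c)).
Proof. by rewrite [RHS]opprB !opprD !opprK addrACA. Qed.

Section Newton.
Variables (k1 k2 : nat) (N1 : 'cV[R]_k1 -> R) (N2 : 'cV[R]_k2 -> R).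
Hypotheses (h1 : is_norm N1) (h2 : is_norm N2).
Local Notation N := (max_norm N1 N2).

(** G1 and G2 stand for components already multiplied by approximate inverses, hence close to the
    two projections. In the maximum norm the components can be estimated separately, each with its
    own constant. *)
Lemma newton_zero (G1 : 'cV[R]_(k1 + k2) -> 'cV[R]_k1)
    (G2 : 'cV[R]_(k1 + k2) -> 'cV[R]_k2) (p : 'cV[R]_(k1 + k2)) (r l1 l2 : R) :
  0 < r -> 0 <= l1 < 1 -> 0 <= l2 < 1 ->
  (forall x x', N (x - p) < r -> N (x' - p) < r ->
    N1 (G1 x - G1 x' - usubmx (x - x')) <= l1 * N (x - x')) ->
  (forall x x', N (x - p) < r -> N (x' - p) < r ->
    N2 (G2 x - G2 x' - dsubmx (x - x')) <= l2 * N (x - x')) ->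
  N1 (G1 p) < (1 - l1) * r -> N2 (G2 p) < (1 - l2) * r ->
  exists x, [/\ N (x - p) < r, G1 x = 0 & G2 x = 0].
Proof.
move=> r0 /andP[l10 l11] /andP[l20 l21] c1 c2 b1 b2.
have hN := max_norm_is_norm h1 h2.
(* The least radius with N_i (G_i p) <= (1 - l_i) r' for both i, which makes the closed ball
   invariant; the strict bounds at p give r' < r, so this ball lies where the contraction estimates
   hold. *)
pose r' := Num.max (N1 (G1 p) / (1 - l1)) (N2 (G2 p) / (1 - l2)).
have d1 : 0 < 1 - l1 by rewrite subr_gt0.
have d2 : 0 < 1 - l2 by rewrite subr_gt0.
have r'r : r' < r by rewrite gt_max !ltr_pdivrMr// ![r * _]mulrC b1 b2.
have r'0 : 0 <= r' by rewrite le_max divr_ge0 ?(nrm_ge0 h1)// ltW.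
have b1' : N1 (G1 p) <= (1 - l1) * r'.
  by rewrite mulrC -ler_pdivrMr// le_max lexx.
have b2' : N2 (G2 p) <= (1 - l2) * r'.
  by rewrite mulrC -ler_pdivrMr// le_max lexx orbT.
pose T x := x - col_mx (G1 x) (G2 x).
have Tu x x' : usubmx (T x - T x') = - (G1 x - G1 x' - usubmx (x - x')).
  by rewrite /T !usubmxB !col_mxKu subrB_swap.
have Td x x' : dsubmx (T x - T x') = - (G2 x - G2 x' - dsubmx (x - x')).
  by rewrite /T !dsubmxB !col_mxKd subrB_swap.
have inb x : N (x - p) <= r' -> N (x - p) < r.
  by move=> h; exact: le_lt_trans r'r.
have pp : N (p - p) < r by rewrite subrr (nrm0 hN).
have Tp : T p - p = - col_mx (G1 p) (G2 p) by rewrite /T addrC addKr.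
have [||||x xr Tx] := @nrm_contraction_fixpoint R _ _ hN T p r' (Num.max l1 l2).
- exact: r'0.
- by rewrite gt_max l11 l21.
- move=> x xr'; have xr := inb _ xr'.
  (* T x - p is split at T p: the contraction bounds T x - T p by l_i r', and T p - p by (1 - l_i)
     r', in each component. *)
  rewrite -(subrKA (T p)) Tp /max_norm ge_max; apply/andP; split.
    rewrite linearB /= Tu col_mxKu -opprD (nrmN h1).
    apply: le_trans (nrmD h1 _ _) _.
    apply: le_trans (lerD (c1 _ _ xr pp) b1') _.
    apply: (@le_trans _ _ (l1 * r' + (1 - l1) * r')).
      by rewrite lerD2r ler_wpM2l.
    by rewrite -mulrDl addrC subrK mul1r.
  rewrite linearB /= Td col_mxKd -opprD (nrmN h2).
  apply: le_trans (nrmD h2 _ _) _.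
  apply: le_trans (lerD (c2 _ _ xr pp) b2') _.
  apply: (@le_trans _ _ (l2 * r' + (1 - l2) * r')).
    by rewrite lerD2r ler_wpM2l.
  by rewrite -mulrDl addrC subrK mul1r.
- move=> x x' /inb xr /inb x'r.
  rewrite [leLHS]/max_norm ge_max Tu Td (nrmN h1) (nrmN h2); apply/andP; split.
    apply: le_trans (c1 _ _ xr x'r) _.
    by rewrite ler_wpM2r ?(nrm_ge0 hN)// le_max lexx.
  apply: le_trans (c2 _ _ xr x'r) _.
  by rewrite ler_wpM2r ?(nrm_ge0 hN)// le_max lexx orbT.
exists x; have /eqP : col_mx (G1 x) (G2 x) = 0.
  apply/eqP; rewrite -oppr_eq0 -(subr_eq0 _ 0) subr0.
  by rewrite -(addKr x (- _)) -/(T x) Tx addNr.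
by rewrite col_mx_eq0 => /andP[/eqP g1 /eqP g2]; split=> //; exact: inb.
Qed.

End Newton.
End OperatorNorms.

(** * Partial derivatives and mean value theorems *)

Section Derivatives.
Context {R : realType}.

Lemma dnbhs_neq0 : (0 : R)^' [set h | h != 0].
Proof. by rewrite /dnbhs /within /=; apply: nearW. Qed.

(** The filter is left general so that the same limit gives the two-sided directional derivatives in
    [jac] and the possibly one-sided ones in [derive_in]. *)
Lemma fderiv_quotient (V W : normedModType R) (S : set V) (g : V -> W) (x v : V)
    (L : V -> W) (F : set_system R) : Filter F ->
  bounded_lin L -> fderiv S g x L -> F --> (0 : R)^' ->
  (\forall h \near F, S (x + h *: v)) ->
  h^-1 *: (g (x + h *: v) - g x) @[h --> F] --> L v.
Proof.
move=> FF [lL _] gL F0 FS.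
have line0 : (x + h *: v) @[h --> F] --> nbhs x.
  have h0 : h @[h --> F] --> (0 : R).
    by move=> A /nbhs_dnbhs hA; exact: F0.
  rewrite -[X in _ --> nbhs X]addr0 -(scale0r v).
  by apply: cvgD; [exact: cvg_cst|apply: cvgZ => //; exact: cvg_cst].
apply/cvgrPdist_le => e e0.
have e1 : 0 < e / (1 + `|v|) by rewrite divr_gt0// ltr_pwDl.
have hL := gL _ e1; rewrite near_withinE in hL.
have hF : \forall h \near F, S (x + h *: v) ->
    `|g (x + h *: v) - g x - L (x + h *: v - x)|
      <= e / (1 + `|v|) * `|x + h *: v - x| by exact: (line0 _ hL).
have n0 : \forall h \near F, h != 0.
  by apply: (F0 [set h | h != 0]); exact: dnbhs_neq0.
near=> h.
have h0 : h != 0 by near: h.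
have hS : S (x + h *: v) by near: h.
have := (near hF h _) hS; move=> /(_ ltac:(by [])).
rewrite [x + _ - x]addrC addKr (linZ _ _ lL) normrZ => hh.
have -> : L v - h^-1 *: (g (x + h *: v) - g x) =
   - (h^-1 *: (g (x + h *: v) - g x - h *: L v)).
  by rewrite [in RHS]scalerBr scalerA mulVf// scale1r opprB.
rewrite normrN normrZ normfV ler_pdivrMl ?normr_gt0//.
apply: le_trans hh _.
rewrite mulrC -mulrA ler_pM2l ?normr_gt0//.
rewrite mulrA ler_pdivrMr ?ltr_pwDl// mulrC ler_pM2l// lerDr//.
Unshelve. all: by end_near. Qed.

Lemma fderiv_is_derive (V W : normedModType R) (S : set V) (g : V -> W)
    (x v : V) (L : V -> W) :
  nbhs x S -> bounded_lin L -> fderiv S g x L -> is_derive x v g (L v).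
Proof.
move=> xS bL gL.
have hS : \forall h \near (0 : R)^', S (x + h *: v).
  have h0 : (x + h *: v) @[h --> (0 : R)] --> nbhs x.
    rewrite -[X in _ --> nbhs X]addr0 -(scale0r v).
    by apply: cvgD; [exact: cvg_cst|apply: cvgZ => //; exact: cvg_cst].
  by apply: nbhs_dnbhs; exact: (h0 _ xS).
have hc : (0 : R)^' --> (0 : R)^' by [].
have h := fderiv_quotient _ bL gL hc hS.
have {}h : h^-1 *: ((g \o shift x) (h *: v) - g x) @[h --> (0 : R)^'] --> L v.
  rewrite (eq_cvg _ _ (g := fun h => h^-1 *: (g (x + h *: v) - g x))).
    exact: h.
  by move=> h1 /=; rewrite [_ *: v + x]addrC.
apply: DeriveDef; first by apply/cvg_ex; exists (L v).
by apply/cvg_lim => //; exact: norm_hausdorff.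
Qed.

Lemma fderiv_jac m p (S : set 'cV[R]_m) (g : 'cV[R]_m -> 'cV[R]_p) x L :
  nbhs x S -> linear L -> fderiv S g x L -> forall v, jac g x *m v = L v.
Proof.
move=> xS lL gL v; have bL := fin_dim_bounded (fin_dim_cV m) lL.
rewrite [in RHS](matrix_sum_delta v).
transitivity (\sum_(j < m) v j 0 *: L (delta_mx j 0)); last first.
  rewrite -(lin_sumZ _ _ lL); congr L; apply: eq_bigr => j _.
  by rewrite big_ord1.
apply/colP => i; rewrite mxE summxE; apply: eq_bigr => j _.
rewrite !mxE mulrC; congr (_ * (_ : 'cV[R]_p) i 0).
by have [_ ->] := fderiv_is_derive (delta_mx j 0) xS bL gL.
Qed.

Lemma derive_in_fderiv (W : normedModType R) (E : set R) (g : R -> W) (e : R)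
    (d : W) :
  ProperFilter (within [set h | E (e + h)] (0 : R)^') ->
  fderiv (E : set R^o) g e (fun h => h *: d) -> derive_in E g e = d.
Proof.
move=> PF gd; apply/cvg_lim; first exact: norm_hausdorff.
have bL : bounded_lin (fun h : R^o => h *: d).
  apply: fin_dim_bounded; first exact: fin_dim_R.
  by move=> a u v; rewrite scalerDl scalerA.
have hc : within [set h | E (e + h)] (0 : R)^' --> (0 : R)^'.
  exact: cvg_within.
have hS : \forall h \near within [set h | E (e + h)] (0 : R)^',
    (E : set R^o) ((e : R^o) + h *: (1 : R^o)).
  by rewrite near_withinE; apply: nearW => h /=; rewrite [h *: _]mulr1.
have := fderiv_quotient _ bL gd hc hS; rewrite scale1r => /(_ _) q.
rewrite (eq_cvg _ _ (g := fun h => h^-1 *: (g (e + h *: (1 : R^o)) - g e))).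
  exact: q.
by move=> h; rewrite [_ *: (1 : R^o)]mulr1.
Qed.

(** It makes the limit defining [derive_in] unique at every point of the interval, end points
    included: points e in the left half are approached from the right, the others from the left,
    with steps of length at most e0 / 2. *)
Lemma proper_within_itv (e0 e : R) : 0 < e0 -> 0 <= e <= e0 ->
  ProperFilter (within [set h | `[0, e0]%classic (e + h)] (0 : R)^').
Proof.
move=> e00 /andP[e1 e2]; apply: Build_ProperFilter_ex.
move=> P; rewrite /within /dnbhs /within /= => /nbhs_ballP[d /= d0 hP].
have [eh|eh] := leP e (e0 / 2).
  pose h := Num.min (d / 2) (e0 / 2).
  have h0 : 0 < h by rewrite lt_min !divr_gt0.
  exists h; apply: hP => //.
  - rewrite -ball_normE /ball_ /= sub0r normrN gtr0_norm//.
    by rewrite gt_min ltr_pdivrMr// ltr_pMr// ltrDl ltr01.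
  - by rewrite gt_eqF.
  - rewrite in_itv /= addr_ge0 ?(ltW h0)//=.
    have : h <= e0 / 2 by rewrite ge_min lexx orbT.
    by move: eh; lra.
pose h := Num.min (d / 2) (e0 / 2).
have h0 : 0 < h by rewrite lt_min !divr_gt0.
exists (- h); apply: hP => //.
- rewrite -ball_normE /ball_ /= sub0r opprK gtr0_norm//.
  by rewrite gt_min ltr_pdivrMr// ltr_pMr// ltrDl ltr01.
- by rewrite oppr_eq0 gt_eqF.
- have : h <= e0 / 2 by rewrite ge_min lexx orbT.
  by rewrite in_itv /=; move: eh e2 h0; lra.
Qed.

Lemma fderiv_mx (V : normedModType R) p q (S : set V) (g : V -> 'M[R]_(p, q))
    x (L : V -> 'M[R]_(p, q)) :
  (forall i j, fderiv S (fun s => g s i j : R^o) x (fun v => L v i j)) ->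
  fderiv S g x L.
Proof.
move=> h e e0.
have hh (ij : 'I_p * 'I_q) : within S (nbhs x)
   [set y | `|g y ij.1 ij.2 - g x ij.1 ij.2 - L (y - x) ij.1 ij.2|
     <= e * `|y - x|].
  exact: (h ij.1 ij.2 e e0).
have hA : \forall y \near within S (nbhs x), forall ij : 'I_p * 'I_q,
   `|g y ij.1 ij.2 - g x ij.1 ij.2 - L (y - x) ij.1 ij.2| <= e * `|y - x|.
  exact: (filter_forall _ hh).
near=> y.
have hy : forall ij : 'I_p * 'I_q,
    `|g y ij.1 ij.2 - g x ij.1 ij.2 - L (y - x) ij.1 ij.2| <= e * `|y - x|.
  by near: y.
apply: mx_norm_le => [|i j]; first by rewrite mulr_ge0// ltW.
by rewrite !mxE; exact: (hy (i, j)).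
Unshelve. all: by end_near. Qed.

Lemma fderiv_entry (V : normedModType R) p q (S : set V) (g : V -> 'M[R]_(p, q))
    x (L : V -> 'M[R]_(p, q)) i j :
  fderiv S g x L -> fderiv S (fun s => g s i j : R^o) x (fun v => L v i j).
Proof.
move=> h e e0; apply: filterS (h e e0) => y; apply: le_trans.
by have := mx_norm_coord (g y - g x - L (y - x)) i j; rewrite !mxE.
Qed.

(** Derivatives relative to [a, b] are two-sided in the open interval and give continuity up to the
    end points, which are the hypotheses of [MVT]. *)
Lemma scalar_mean_value (f f' : R -> R) (a b : R) : a < b ->
  (forall s, a <= s <= b ->
    fderiv [set x | a <= x <= b] (f : R^o -> R^o) s (fun h => h * f' s)) ->
  exists2 c, a <= c <= b & f b - f a = f' c * (b - a).
Proof.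
move=> ab hf.
have bl s : bounded_lin (fun h : R^o => h * f' s : R^o).
  apply: fin_dim_bounded; first exact: fin_dim_R.
  by move=> k u v; rewrite mulrDl -[k *: u]/(k * u) -mulrA.
have [||c cab ->] := @MVT R f f' a b ab.
- move=> x; rewrite in_itv /= => /andP[ax xb].
  have xab : a <= x <= b by rewrite !ltW.
  have nx : nbhs (x : R^o) [set y | a <= y <= b].
    have hx : x \in `]a, b[ by rewrite in_itv /= ax.
    apply: filterS (near_in_itvoo hx) => y /=.
    by rewrite in_itv /= => /andP[/ltW -> /ltW ->].
  have := fderiv_is_derive (1 : R^o) nx (bl x) (hf _ xab).
  by rewrite mul1r.
- apply/(within_continuousP (V := R^o) (W := R^o)) => x.
  rewrite /= in_itv /= => xab.
  have := fderiv_cvg (bl x) (hf _ xab).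
  by rewrite (_ : [set y | a <= y <= b] = `[a, b]%classic)// set_itvcc.
- exists c => //; move: cab; rewrite in_itv /= => /andP[/ltW -> /ltW ->].
  by [].
Qed.

Lemma mean_value_rows m p (U : set 'cV[R]_m) (g : 'cV[R]_m -> 'cV[R]_p)
    (J : 'cV[R]_m -> 'M[R]_(p, m)) (x x' : 'cV[R]_m) :
  (forall t : R, 0 <= t <= 1 -> U (x' + t *: (x - x'))) ->
  (forall y, U y -> fderiv U g y (fun v => J y *m v)) ->
  exists2 Q : 'M[R]_(p, m), g x - g x' = Q *m (x - x') &
    forall i, exists2 xi, U xi & forall j, Q i j = J xi i j.
Proof.
move=> segU gJ.
have lJ y : linear (fun v : 'cV[R]_m => J y *m v).
  by move=> a u v; rewrite mulmxDr scalemxAr.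
have row i : exists xi, U xi /\
    (g x - g x') i 0 = (J xi *m (x - x')) i 0.
  pose l (t : R^o) : 'cV[R]_m := x' + t *: (x - x').
  pose f (t : R) := g (l t) i 0; pose f' t := (J (l t) *m (x - x')) i 0.
  have [s s01|c c01] := @scalar_mean_value f f' 0 1 ltr01.
    have ll : linear (fun t : R^o => t *: (x - x')).
      by move=> a u v; rewrite scalerDl scalerA.
    have dl : fderiv [set t : R^o | 0 <= t <= 1] l s (fun t => t *: (x - x')).
      have := fderivD (@fderiv_cst R _ _ [set t : R^o | 0 <= t <= 1] x' s)
        (fderiv_lin _ s ll).
      move=> h e e0; apply: filterS (h e e0) => y /=.
      by rewrite /cst add0r.
    have := fderiv_comp segU (fin_dim_bounded fin_dim_R ll)
      (fin_dim_bounded (fin_dim_cV _) (lJ _)) dl (gJ _ (segU _ s01)).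
    move=> /(fderiv_entry i 0) h e e0; apply: filterS (h e e0) => y /=.
    by rewrite -scalemxAr mxE.
  rewrite /f /f' /l subr0 mulr1 scale1r scale0r addr0 [x' + _]addrC subrK.
  by move=> h; exists (l c); split; [exact: segU|rewrite !mxE in h *].
have [xi hxi] := choice row.
exists (\matrix_(i, j) J (xi i) i j).
  apply/colP => i; rewrite (hxi i).2 !mxE; apply: eq_bigr => j _.
  by rewrite !mxE.
by move=> i; exists (xi i); [exact: (hxi i).1|move=> j; rewrite mxE].
Qed.

Lemma pair_inr_linear (V W : normedModType R) :
  linear (fun v : V => (0 : W, v)).
Proof.
move=> a u v.
have -> : a *: (0 : W, u) + (0, v) = (a *: 0 + 0, a *: u + v) by [].
by rewrite scaler0 addr0.
Qed.

Lemma pair_inl_linear (V W : normedModType R) :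
  linear (fun v : V => (v, 0 : W)).
Proof.
move=> a u v.
have -> : a *: (u, 0 : W) + (v, 0) = (a *: u + v, a *: 0 + 0) by [].
by rewrite scaler0 addr0.
Qed.

Section Partials.
Variables (k m : nat) (e0 : R) (U : set 'cV[R]_k).
Variable g : R -> 'cV[R]_k -> 'cV[R]_m.
Let E : set R^o := `[0, e0]%classic.
Hypotheses (e00 : 0 < e0) (oU : open U).
Hypothesis hg : Cr 2 (E `*` U) (fun p : R^o * 'cV[R]_k => g p.1 p.2).

Let fin_dim_RU : fin_dim (R^o * 'cV[R]_k)%type.
Proof. exact: fin_dim_prod fin_dim_R (fin_dim_cV _). Qed.

Let inE0 e : E e -> 0 <= e <= e0. Proof. by rewrite /E /= in_itv. Qed.

Lemma fderiv_partial_x (W : normedModType R) (f : R^o * 'cV[R]_k -> W) L e x :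
  linear L -> fderiv (E `*` U) f (e, x) L -> E e ->
  fderiv U (fun y => f (e, y)) x (fun v => L (0, v)).
Proof.
move=> lL fL Ee.
have li := @pair_inr_linear 'cV[R]_k R^o.
apply: (fderiv_comp (T := E `*` U) (f := fun y => (e, y))
  (Df := fun v => (0, v)) (Dg := L)) => //.
- exact: fin_dim_bounded (fin_dim_cV _) li.
- exact: fin_dim_bounded.
- apply: fderiv_pair; first exact: fderiv_cst.
  exact: fderiv_lin.
Qed.

Lemma fderiv_partial_t (W : normedModType R) (f : R^o * 'cV[R]_k -> W) L e x :
  linear L -> fderiv (E `*` U) f (e, x) L -> U x ->
  fderiv E (fun s => f (s, x)) e (fun h => h *: L (1, 0)).
Proof.
move=> lL fL Ux.
have li := @pair_inl_linear R^o 'cV[R]_k.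
have -> : (fun h => h *: L (1, 0)) = (fun h => L (h, 0)).
  apply/funext => h; rewrite -(linZ _ _ lL); congr L.
  rewrite (_ : h *: (1, 0) = (h *: (1 : R^o), h *: (0 : 'cV[R]_k)))//.
  by rewrite scaler0 [h *: _]mulr1.
apply: (fderiv_comp (T := E `*` U) (f := fun s => (s, x))
  (Df := fun h => (h, 0)) (Dg := L)) => //.
- exact: fin_dim_bounded fin_dim_R li.
- exact: fin_dim_bounded.
- apply: fderiv_pair; last exact: fderiv_cst.
  exact: fderiv_lin.
Qed.

Lemma C2_partial_x e x : E e -> U x ->
  fderiv U (g e) x (fun v => jac (g e) x *m v).
Proof.
move=> Ee Ux; have /CrS[Dg [lD D1 D2]] := hg.
have h := fderiv_partial_x (lD _) (D1 (e, x) (conj Ee Ux)) Ee.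
have ll : linear (fun v => Dg (e, x) (0, v)).
  by move=> a u v; rewrite (@pair_inr_linear _ R^o a u v) lD.
have nU : nbhs x U by exact: open_nbhs_nbhs.
rewrite (_ : (fun v => _) = fun v => Dg (e, x) (0, v))//.
by apply/funext => v; exact: (fderiv_jac nU ll h).
Qed.

Lemma C2_partial_t e x : E e -> U x ->
  fderiv E (fun s => g s x) e (fun h => h *: derive_in E (fun s => g s x) e).
Proof.
move=> Ee Ux; have /CrS[Dg [lD D1 D2]] := hg.
have h := fderiv_partial_t (lD _) (D1 (e, x) (conj Ee Ux)) Ux.
have PF := proper_within_itv e00 (inE0 Ee).
by rewrite (derive_in_fderiv PF h).
Qed.

(** Continuity on the compact E makes the supremum of the norm of this derivative finite, so that
    [set_norm] is a genuine bound. *)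
Lemma C2_partial_t_continuous x : U x ->
  {within E, continuous (fun e => derive_in E (fun s => g s x) e)}.
Proof.
move=> Ux; have /CrS[Dg [lD D1 D2]] := hg.
have c : Cr 0 E (fun e => Dg (e, x) (1, 0)).
  have c1 : Cr 0 E (fun s : R^o => (s, x)).
    apply: Cr_pair; last exact: Cr_cst.
    by apply: Cr_lin; exact: fin_dim_bounded fin_dim_R _.
  have c2 := CrW fin_dim_RU (D2 (1, 0)).
  exact: (Cr_comp fin_dim_R fin_dim_RU (T := E `*` U) _ c1 c2).
apply: Cr_eq c => // e /set_mem Ee.
have h := fderiv_partial_t (lD _) (D1 (e, x) (conj Ee Ux)) Ux.
have PF := proper_within_itv e00 (inE0 Ee).
by rewrite (derive_in_fderiv PF h).
Qed.

(** Column j of the Jacobian is Dg (s, x) (0, e_j), the derivative of g in a fixed direction; the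
    second level of [Cr 2] differentiates it in s. *)
Lemma C2_partial_tx e x : E e -> U x ->
  fderiv E (fun s => jac (g s) x) e
    (fun h => h *: derive_in E (fun s => jac (g s) x) e).
Proof.
move=> Ee Ux; have /CrS[Dg [lD D1 D2]] := hg.
have nU : nbhs x U by exact: open_nbhs_nbhs.
have col_diff j : exists d : 'cV[R]_m, fderiv E (fun s => col j (jac (g s) x)) e
    (fun h => h *: d).
  have /CrS[D2g [lD2 D21 _]] := D2 (0, delta_mx j 0).
  exists (D2g (e, x) (1, 0)).
  have h := fderiv_partial_t (lD2 _) (D21 (e, x) (conj Ee Ux)) Ux.
  move=> r r0; have := h r r0; rewrite !near_withinE; apply: filterS.
  move=> s hs Es; have {}hs := hs Es.
  have colE s' : E s' -> col j (jac (g s') x) = Dg (s', x) (0, delta_mx j 0).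
    move=> Es'.
    have h' := fderiv_partial_x (lD _) (D1 (s', x) (conj Es' Ux)) Es'.
    rewrite -(@fderiv_jac _ _ U (g s') x (fun v => Dg (s', x) (0, v)))//.
      by rewrite colE.
    by move=> a u v; rewrite (@pair_inr_linear _ R^o a u v) lD.
  by rewrite (colE s Es) (colE e Ee).
have [d hd] := choice col_diff.
have h : fderiv E (fun s => jac (g s) x) e
    (fun h => h *: \matrix_(i, j) d j i 0).
  apply: fderiv_mx => i j; have := fderiv_entry i 0 (hd j).
  rewrite (_ : (fun s => col j (jac (g s) x) i 0) = fun s => jac (g s) x i j).
    rewrite (_ : (fun h => (h *: d j) i 0) =
      fun h => (h *: \matrix_(i, j) d j i 0) i j)//.
    by apply/funext => h; rewrite !mxE.
  by apply/funext => s; rewrite [LHS]mxE.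
have PF := proper_within_itv e00 (inE0 Ee).
by rewrite (derive_in_fderiv PF h).
Qed.

End Partials.

End Derivatives.

(** * A nondegenerate zero of y *)

Section TransversalZero.
Context {R : realType}.

Lemma mx_subE m n (A B : 'M[R]_(m, n)) i j : (A - B) i j = A i j - B i j.
Proof. by rewrite !mxE. Qed.

Lemma mx_scaleE m n a (A : 'M[R]_(m, n)) i j : (a *: A) i j = a * A i j.
Proof. by rewrite mxE. Qed.

(** Common to both components: P is the projection onto the component, so A P is (A_11, 0) or (0,
    A_22), and B = A^-1, l = |Delta| / m(A). Both estimates with l rest on A^-1 (M - A P) = A^-1 M -
    P, with M a mean value matrix for the contraction and M = J, applied to a vector of its kernel,
    for nondegeneracy. *)
Lemma newton_component k m (N : 'cV[R]_k -> R) (Ni : 'cV[R]_m -> R)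
    (A : 'M[R]_m) (P lo hi : 'M[R]_(m, k)) (F : 'cV[R]_k -> 'cV[R]_m)
    (p : 'cV[R]_k) (r b : R) :
  is_norm N -> is_norm Ni -> 0 < r -> 0 <= b ->
  ((0 < m)%N ->
    b + set_norm (op_norm N Ni) (interval_mx lo hi) * r < co_norm Ni A * r) ->
  (forall x x', N (x - p) < r -> N (x' - p) < r ->
    exists2 Q, F x - F x' = Q *m (x - x') & interval_mx lo hi (Q - A *m P)) ->
  Ni (F p) <= b ->
  exists (l : R) (B : 'M[R]_m),
  [/\ 0 <= l < 1,
    forall x x', N (x - p) < r -> N (x' - p) < r ->
      Ni (B *m F x - B *m F x' - P *m (x - x')) <= l * N (x - x'),
    Ni (B *m F p) < (1 - l) * r,
    forall v : 'cV[R]_m, B *m v = 0 -> v = 0 &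
    forall (J : 'M[R]_(m, k)) (v : 'cV[R]_k),
      interval_mx lo hi (J - A *m P) -> J *m v = 0 ->
      Ni (P *m v) <= l * N v].
Proof.
move=> hN hNi r0 b0 hineq hF hb.
(* For m = 0 the inequality is omitted and the target space is trivial, so l = 0 and the identity
   do. *)
case: (posnP m) => [m0|/hineq {}hineq].
  have N0 v : Ni v = 0 by exact: nrm_dim0.
  exists 0, 1%:M; split.
  - by rewrite lexx ltr01.
  - by move=> *; rewrite N0 mul0r.
  - by rewrite N0 subr0 mul1r.
  - by move=> v; rewrite mul1mx.
  - by move=> *; rewrite N0 mul0r.
set D := set_norm _ _ in hineq.
have D0 : 0 <= D by apply: set_norm_ge0 => M; exact: op_norm_ge0.
have co0 : 0 < co_norm Ni A.
  rewrite -(pmulr_lgt0 _ r0); apply: le_lt_trans hineq.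
  by rewrite addr_ge0// mulr_ge0// ltW.
have [uA hA] := co_norm_gt0 hNi co0.
have bound M v : interval_mx lo hi M ->
    Ni (invmx A *m (M *m v)) <= (co_norm Ni A)^-1 * D * N v.
  move=> hM; apply: le_trans (hA _) _; rewrite -mulrA ler_pM2l ?invr_gt0//.
  apply: le_trans (op_norm_le hN hNi _ _) _.
  by rewrite ler_wpM2r ?(nrm_ge0 hN)//; exact: set_norm_interval_le.
exists ((co_norm Ni A)^-1 * D), (invmx A); split.
- rewrite mulr_ge0 ?invr_ge0 ?(ltW co0)//= mulrC ltr_pdivrMr// mul1r.
  by rewrite -(ltr_pM2r r0); apply: le_lt_trans hineq; rewrite lerDr.
- move=> x x' xr x'r; have [Q FQ QD] := hF x x' xr x'r.
  rewrite -mulmxBr FQ.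
  have -> : P *m (x - x') = invmx A *m (A *m P *m (x - x')).
    by rewrite !mulmxA mulVmx// mul1mx.
  by rewrite -mulmxBr -mulmxBl; exact: bound.
(* The assumed inequality divided by m(A): b / m(A) < (1 - l) r. *)
- apply: le_lt_trans (hA _) _.
  apply: (@le_lt_trans _ _ ((co_norm Ni A)^-1 * b)).
    by rewrite ler_pM2l ?invr_gt0.
  rewrite mulrC ltr_pdivrMr//.
  have -> : (1 - (co_norm Ni A)^-1 * D) * r * co_norm Ni A =
     co_norm Ni A * r - D * r by field; rewrite gt_eqF.
  by rewrite ltrBrDr.
- by move=> v /(congr1 (mulmx A)); rewrite mulmxA mulmxV// mul1mx mulmx0.
- move=> J v hJ Jv.
  have -> : P *m v = - (invmx A *m ((J - A *m P) *m v)).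
    by rewrite mulmxBl Jv sub0r mulmxN opprK !mulmxA mulVmx// mul1mx.
  by rewrite (nrmN hNi); exact: bound.
Qed.

Lemma fderiv_sub (V W : normedModType R) (S T : set V) (g : V -> W) x L :
  T `<=` S -> fderiv S g x L -> fderiv T g x L.
Proof.
move=> TS h e e0; have := h e e0; rewrite !near_withinE; apply: filterS.
by move=> y hy /TS.
Qed.

Section Setting.
Variables (k1 k2 : nat) (N1 : 'cV[R]_k1 -> R) (N2 : 'cV[R]_k2 -> R).
Hypotheses (h1 : is_norm N1) (h2 : is_norm N2).
Local Notation k := (k1 + k2)%N.
Local Notation N := (max_norm N1 N2).
Let hN : is_norm N := max_norm_is_norm h1 h2.
Variables (e0 : R) (p : 'cV[R]_k) (r : R) (y : R -> 'cV[R]_k -> 'cV[R]_k).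
Hypotheses (e00 : 0 < e0) (r0 : 0 < r).
Local Notation E := (`[0, e0]%classic : set R^o).
Local Notation U := [set x | N (x - p) < r].
Hypothesis oU : open U.
Hypothesis hy : Cr 2 (E `*` U) (fun q : R^o * 'cV[R]_k => y q.1 q.2).
Let y1 (e : R) (x : 'cV[R]_k) : 'cV[R]_k1 := usubmx (y e x).
Let y2 (e : R) (x : 'cV[R]_k) : 'cV[R]_k2 := dsubmx (y e x).

Let Up : U p. Proof. by rewrite /= subrr (nrm0 hN). Qed.

Let E0 : E 0. Proof. by rewrite /= in_itv /= lexx ltW. Qed.

Lemma ball_segment x x' (t : R) :
  U x -> U x' -> 0 <= t <= 1 -> U (x' + t *: (x - x')).
Proof.
move=> /= xr x'r /andP[t0 t1].
have -> : x' + t *: (x - x') - p = t *: (x - p) + (1 - t) *: (x' - p).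
  apply/matrixP => i j; rewrite !mxE; ring.
apply: le_lt_trans (nrmD hN _ _) _; rewrite !(nrmZ hN) !ger0_norm ?subr_ge0//.
pose M := Num.max (N (x - p)) (N (x' - p)).
apply: (@le_lt_trans _ _ (t * M + (1 - t) * M)).
  apply: lerD; apply: ler_wpM2l => //; rewrite ?subr_ge0// le_max lexx//.
  by rewrite orbT.
by rewrite -mulrDl addrC subrK mul1r gt_max xr x'r.
Qed.

(** The factor e is at most [e0] for y_1 and cancels against 1/e for the rescaled y_2; hence eps
    multiplies the derivative in the first inequality of the theorem and not in the second. *)
Lemma nrm_derive_in_le m (Ni : 'cV[R]_m -> R)
    (g : R -> 'cV[R]_k -> 'cV[R]_m) e :
  is_norm Ni -> Cr 2 (E `*` U) (fun q : R^o * 'cV[R]_k => g q.1 q.2) -> E e ->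
  g 0 p = 0 ->
  Ni (g e p) <= e * set_norm Ni [set derive_in E (fun s => g s p) e | e in E].
Proof.
move=> hNi hg Ee g0; set S := set_norm _ _.
have /andP[e_ge0 e_le] : 0 <= e <= e0 by move: Ee; rewrite /= in_itv.
have cN : {within E, continuous (fun e => Ni (derive_in E (fun s => g s p) e))}.
  apply/(within_continuousP (W := R^o)) => s Es.
  have /(within_continuousP (W := 'cV[R]_m)) c :=
    C2_partial_t_continuous e00 hg Up.
  have h : Ni v @[v --> derive_in E (fun s => g s p) s]
      --> Ni (derive_in E (fun s => g s p) s) by exact: nrm_continuous.
  exact: (@cvg_comp _ _ _ (fun e => derive_in E (fun s => g s p) e) Ni _ _ _
    (c s Es) h).
have hs : has_sup (Ni @` [set derive_in E (fun s => g s p) e | e in E]).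
  rewrite image_comp.
  apply: compact_has_sup; first by apply: image_nonempty; exists e; exact: Ee.
  by apply: continuous_compact => //; exact: segment_compact.
have := @nrm_mean_value R m Ni hNi (g ^~ p) (derive_in E (fun s => g s p))
  0 e S e_ge0.
rewrite g0 !subr0 mulrC; apply.
  move=> s /andP[s0 se]; apply: fderiv_sub (C2_partial_t e00 hg _ Up).
    by move=> u /= /andP[u0 ue]; rewrite in_itv /= u0 (le_trans ue).
  by rewrite /= in_itv /= s0 (le_trans se).
move=> s /andP[s0 se]; apply: sup_upper_bound => //.
exists (derive_in E (fun s => g s p) s) => //; exists s => //.
by rewrite /= in_itv /= s0 (le_trans se).
Qed.


(** Nondegeneracy is stated for every linear L that is a derivative of y e at x, so that it applies
    to the derivative later assembled from the two graphs. *)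
Lemma transversal_zero e lo1 hi1 lo2 hi2 :
  y 0 p = 0 ->
  (forall x, U x -> y2 0 x = 0) ->
  let A11 : 'M[R]_k1 := lsubmx (jac (y1 0) p) in
  let d2y2 (e : R) (x : 'cV[R]_k) : 'M[R]_(k2, k) :=
    derive_in E (fun s => jac (y2 s) x) e in
  let A22 : 'M[R]_k2 := rsubmx (d2y2 0 p) in
  encloses lo1 hi1
    [set D | exists e x, [/\ E e, U x & D = jac (y1 e) x - row_mx A11 0]] ->
  encloses lo2 hi2
    [set D | exists e x, [/\ E e, U x & D = d2y2 e x - row_mx 0 A22]] ->
  ((0 < k1)%N ->
     e0 * set_norm N1 [set derive_in E (fun s => y1 s p) e | e in E]
     + set_norm (op_norm N N1) (interval_mx lo1 hi1) * r
     < co_norm N1 A11 * r) ->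
  ((0 < k2)%N ->
     set_norm N2 [set derive_in E (fun s => y2 s p) e | e in E]
     + set_norm (op_norm N N2) (interval_mx lo2 hi2) * r
     < co_norm N2 A22 * r) ->
  0 < e <= e0 ->
  exists x, [/\ U x, y e x = 0 &
    forall L v, linear L -> fderiv U (y e) x L -> L v = 0 -> v = 0].
Proof.
move=> y0 y20 A11 d2y2 A22 enc1 enc2 in1 in2 /andP[e_gt0 e_le].
have Ee : E e by rewrite /= in_itv /= (ltW e_gt0).
have fRU : fin_dim (R^o * 'cV[R]_k)%type.
  exact: fin_dim_prod fin_dim_R (fin_dim_cV _).
have bu : bounded_lin (@usubmx R k1 k2 1).
  by apply: fin_dim_bounded (fin_dim_cV _) _ => a u v; rewrite linearP.
have bd : bounded_lin (@dsubmx R k1 k2 1).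
  by apply: fin_dim_bounded (fin_dim_cV _) _ => a u v; rewrite linearP.
have hy1 : Cr 2 (E `*` U) (fun q : R^o * 'cV[R]_k => y1 q.1 q.2).
  have q := Cr_linc fRU bu hy; exact: q.
have hy2 : Cr 2 (E `*` U) (fun q : R^o * 'cV[R]_k => y2 q.1 q.2).
  have q := Cr_linc fRU bd hy; exact: q.
pose P1 : 'M[R]_(k1, k) := row_mx 1%:M 0.
pose P2 : 'M[R]_(k2, k) := row_mx 0 1%:M.
have AP1 : A11 *m P1 = row_mx A11 0 by rewrite mul_mx_row mulmx1 mulmx0.
have AP2 : A22 *m P2 = row_mx 0 A22 by rewrite mul_mx_row mulmx1 mulmx0.
have P1E x : P1 *m x = usubmx x.
  by rewrite -{1}[x]vsubmxK mul_row_col mul1mx mul0mx addr0.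
have P2E x : P2 *m x = dsubmx x.
  by rewrite -{1}[x]vsubmxK mul_row_col mul1mx mul0mx add0r.
pose F2 x := e^-1 *: y2 e x.
have y1p : y1 0 p = 0 by rewrite /y1 y0 linear0.
have y2p : y2 0 p = 0 by rewrite /y2 y0 linear0.
set b1 := e0 * _ in in1.
set b2 := set_norm N2 _ in in2.
have b1_ge0 : 0 <= b1.
  by rewrite mulr_ge0 ?(ltW e00)//; apply: set_norm_ge0; exact: nrm_ge0.
have b2_ge0 : 0 <= b2 by apply: set_norm_ge0; exact: nrm_ge0.
have int1 x : U x -> interval_mx lo1 hi1 (jac (y1 e) x - A11 *m P1).
  by move=> Ux; rewrite AP1; apply: enc1; exists e, x.
(* The point c depends on the entry. This is harmless, because membership in a box is tested entry
   by entry. *)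
have jac_y2 x i j : U x -> exists2 c, E c & jac (y2 e) x i j = e * d2y2 c x i j.
  move=> Ux.
  have [s s0e|c c0e] := @scalar_mean_value R (fun s => jac (y2 s) x i j)
    (fun s => d2y2 s x i j) 0 e e_gt0.
    have Es : E s.
      by case/andP: s0e => s0 se; rewrite /= in_itv /= s0 (le_trans se).
    have h := fderiv_entry i j (C2_partial_tx e00 oU hy2 Es Ux).
    have {}h : fderiv E (fun u => jac (y2 u) x i j : R^o) s
        (fun h => h * d2y2 s x i j).
      have eqL : (fun v : R^o => (v *: d2y2 s x) i j : R^o) =
          fun v => v * d2y2 s x i j by apply/funext => u; rewrite mxE.
      by rewrite -eqL; exact: h.
    have sub : [set x0 : R^o | 0 <= x0 <= e] `<=` E.
      by move=> u /= /andP[u0 ue]; rewrite in_itv /= u0 (le_trans ue).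
    exact: fderiv_sub sub h.
  (* On the open set U the map y2 0 coincides with 0, so its Jacobian vanishes there. *)
  have -> : jac (y2 0) x i j = 0.
    have nU : nbhs x U by exact: open_nbhs_nbhs.
    have z : fderiv U (y2 0) x (fun=> 0).
      move=> d d0; rewrite near_withinE; apply: nearW => u Uu.
      by rewrite !y20// !subr0 normr0 mulr_ge0// ltW.
    have l0 : linear (fun _ : 'cV[R]_k => 0 : 'cV[R]_k2).
      by move=> a u v /=; rewrite scaler0 addr0.
    have := fderiv_jac nU l0 z (delta_mx j 0).
    by rewrite -colE => /colP/(_ i); rewrite [LHS]mxE => ->; rewrite mxE.
  rewrite !subr0 mulrC => ->; exists c => //.
  by case/andP: c0e => c0 ce; rewrite /= in_itv /= c0 (le_trans ce).
have int2 x i j : U x ->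
    lo2 i j <= (e^-1 *: jac (y2 e) x - A22 *m P2) i j <= hi2 i j.
  move=> Ux; have [c Ec je] := jac_y2 x i j Ux.
  have -> : (e^-1 *: jac (y2 e) x - A22 *m P2) i j =
      (d2y2 c x - row_mx 0 A22) i j.
    by rewrite -AP2 !mx_subE mx_scaleE je mulKf// gt_eqF.
  by apply: enc2; exists c, x.
have seg x x' (Ux : U x) (Ux' : U x') := fun t => @ball_segment x x' t Ux Ux'.
have hF1 x x' : U x -> U x' ->
    exists2 Q, y1 e x - y1 e x' = Q *m (x - x') &
      interval_mx lo1 hi1 (Q - A11 *m P1).
  move=> Ux Ux'.
  have [Q QE hQ] := mean_value_rows (seg x x' Ux Ux')
    (fun u Uu => C2_partial_x oU hy1 Ee Uu).
  exists Q => // i j; have [xi Uxi QJ] := hQ i.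
  by have := int1 xi Uxi i j; rewrite !mx_subE QJ.
have hF2 x x' : U x -> U x' ->
    exists2 Q, F2 x - F2 x' = Q *m (x - x') &
      interval_mx lo2 hi2 (Q - A22 *m P2).
  move=> Ux Ux'.
  have [Q QE hQ] := mean_value_rows (seg x x' Ux Ux')
    (fun u Uu => C2_partial_x oU hy2 Ee Uu).
  exists (e^-1 *: Q); first by rewrite /F2 -scalerBr QE scalemxAl.
  move=> i j; have [xi Uxi QJ] := hQ i.
  have := int2 xi i j Uxi.
  by rewrite !mx_subE !mx_scaleE QJ.
have hb1 : N1 (y1 e p) <= b1.
  apply: le_trans (nrm_derive_in_le h1 hy1 Ee y1p) _.
  by rewrite ler_wpM2r//; apply: set_norm_ge0; exact: nrm_ge0.
have hb2 : N2 (F2 p) <= b2.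
  rewrite /F2 (nrmZ h2) gtr0_norm ?invr_gt0// ler_pdivrMl//.
  exact: nrm_derive_in_le h2 hy2 Ee y2p.
have [l1 [B1 [/andP[l10 l11] c1 p1 z1 j1]]] :=
  newton_component hN h1 r0 b1_ge0 in1 hF1 hb1.
have [l2 [B2 [/andP[l20 l21] c2 p2 z2 j2]]] :=
  newton_component hN h2 r0 b2_ge0 in2 hF2 hb2.
have [||||||x [Ux g1 g2]] := @newton_zero R k1 k2 N1 N2 h1 h2
  (fun x => B1 *m y1 e x) (fun x => B2 *m F2 x) p r l1 l2 r0.
- by rewrite l10.
- by rewrite l20.
- by move=> x x' Ux Ux'; rewrite -P1E; exact: c1.
- by move=> x x' Ux Ux'; rewrite -P2E; exact: c2.
- exact: p1.
- exact: p2.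
exists x; split => //.
  rewrite -[y e x]vsubmxK -/(y1 e x) -/(y2 e x) (z1 _ g1).
  have /eqP := z2 _ g2; rewrite /F2 scaler_eq0 invr_eq0 gt_eqF//= => /eqP ->.
  exact: col_mx0.
move=> L v lL yL Lv.
have nU : nbhs x U by exact: open_nbhs_nbhs.
have bL := fin_dim_bounded (fin_dim_cV _) lL.
have J1 : jac (y1 e) x *m v = 0.
  have q := fderiv_comp (T := setT) (fun _ _ => I) bL bu yL
     (fderiv_lin setT (y e x) bu.1).
  have ll : linear (@usubmx R k1 k2 1 \o L).
    by move=> a u w /=; rewrite lL linearP.
  by rewrite (fderiv_jac nU ll q) /= Lv linear0.
have J2 : jac (y2 e) x *m v = 0.
  have q := fderiv_comp (T := setT) (fun _ _ => I) bL bd yL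
     (fderiv_lin setT (y e x) bd.1).
  have ll : linear (@dsubmx R k1 k2 1 \o L).
    by move=> a u w /=; rewrite lL linearP.
  by rewrite (fderiv_jac nU ll q) /= Lv linear0.
have v1 := j1 _ _ (int1 x Ux) J1.
have J2' : (e^-1 *: jac (y2 e) x) *m v = 0 by rewrite -scalemxAl J2 scaler0.
have v2 := j2 _ _ (fun i j => int2 x i j Ux) J2'.
(* If v were nonzero, both of its components would have norm below N v, which is their maximum. *)
apply: (nrm0_eq0 hN); apply/eqP; apply: contraT => Nv0.
have Nv : 0 < N v by rewrite lt_neqAle eq_sym Nv0 (nrm_ge0 hN).
suff : N v < N v by rewrite ltxx.
rewrite P1E in v1; rewrite P2E in v2.
rewrite {1}/max_norm gt_max; apply/andP; split.
  by apply: le_lt_trans v1 _; rewrite -[ltRHS]mul1r ltr_pM2r.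
by apply: le_lt_trans v2 _; rewrite -[ltRHS]mul1r ltr_pM2r.
Qed.

End Setting.
End TransversalZero.

(** * Graphs over the (x, z) coordinates *)

Section Geometry.
Context {R : realType}.

Lemma fderiv_unique (V W : normedModType R) (S : set V) (g : V -> W) x L L' :
  nbhs x S -> bounded_lin L -> bounded_lin L' ->
  fderiv S g x L -> fderiv S g x L' -> forall v, L v = L' v.
Proof.
move=> xS bL bL' h h' v.
have [_ <-] := fderiv_is_derive v xS bL h.
by have [_ <-] := fderiv_is_derive v xS bL' h'.
Qed.

Lemma fderiv_eq (V W : normedModType R) (S : set V) (g h : V -> W) x L :
  (forall y, S y -> g y = h y) -> S x -> fderiv S g x L -> fderiv S h x L.
Proof.
move=> gh Sx hg e e0; have := hg e e0; rewrite !near_withinE; apply: filterS.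
by move=> y hy Sy; rewrite -!gh//; exact: hy.
Qed.

Lemma Cr_fderiv r (V W : normedModType R) (S : set V) (g : V -> W) x :
  fin_dim V -> S x -> Cr r.+1 S g ->
  exists L, bounded_lin L /\ fderiv S g x L.
Proof.
move=> fV Sx /CrS[Dg [lD D1 _]]; exists (Dg x); split; last exact: D1.
exact: fin_dim_bounded.
Qed.

Lemma injective_linear_surjective k (L : 'cV[R]_k -> 'cV[R]_k) :
  linear L -> (forall v, L v = 0 -> v = 0) -> forall w, exists v, L v = w.
Proof.
move=> lL inj; pose M : 'M[R]_k := \matrix_(i, j) L (delta_mx j 0) i 0.
have LM v : L v = M *m v.
  rewrite {1}(matrix_sum_delta v).
  transitivity (\sum_(j < k) v j 0 *: L (delta_mx j 0)).
    rewrite -(lin_sumZ _ _ lL); congr L; apply: eq_bigr => j _.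
    by rewrite big_ord1.
  apply/colP => i; rewrite !mxE summxE; apply: eq_bigr => j _.
  by rewrite !mxE mulrC.
have uM : M \in unitmx.
  rewrite -unitmx_tr -row_free_unit -kermx_eq0.
  apply/rowV0P => v /sub_kermxP vM.
  have : v^T = 0 by apply: inj; rewrite LM -[M]trmxK -trmx_mul vM trmx0.
  by move=> /(congr1 trmx); rewrite trmxK trmx0.
by move=> w; exists (invmx M *m w); rewrite LM mulmxA mulmxV// mul1mx.
Qed.

(* psi factors through a chart of the atlas A, so the image of its derivative
   lies in the tangent space; equality is not needed to span R^n. *)
Lemma tangent_contains_image d n (W : set 'cV[R]_n)
    (A : set (lparam d 'cV[R]_n)) (psi : lparam d 'cV[R]_n) u D :
  C2_submanifold W A -> parameterises_piece W A psi -> ldom psi u ->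
  bounded_lin D -> fderiv (ldom psi) psi u D ->
  exists2 T, is_tangent_space A (psi u) T & forall v, D v \in T.
Proof.
move=> [[[val cov] _ _ _] imm] [[opsi _ subW] tr] psiu bD hD.
have [phi Aphi] := cov _ (subW _ (ex_intro2 _ _ u psiu erefl)).
move=> phiu; have [_ [oO [tau Ctau tauE]]] := tr phi Aphi.
pose O := ldom psi `&` psi @^-1` limage phi.
have Ou : O u by split.
have [phitau phiE] := tauE u Ou.
have [Dtau [bDtau hDtau]] := Cr_fderiv (fin_dim_cV _) Ou Ctau.
have [ophi _ _] := val _ Aphi.
have [Cphi _] := imm _ Aphi.
have [Dphi [bDphi hDphi]] := Cr_fderiv (fin_dim_cV _) phitau Cphi.
have nphi : nbhs (tau u) (ldom phi) by exact: open_nbhs_nbhs.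
have nO : nbhs u O by exact: open_nbhs_nbhs.
exists (limg (linfun (mulmx (jac phi (tau u)) : 'cV[R]_d -> 'cV[R]_n))).
  by exists phi, (tau u).
move=> v.
have h1 : fderiv O psi u (Dphi \o Dtau).
  apply: (fderiv_eq (g := phi \o tau)) => //.
    by move=> w /tauE[].
  by apply: (fderiv_comp (T := ldom phi)) => // w /tauE[].
have h2 : fderiv O psi u D by apply: fderiv_sub hD => w [].
rewrite (fderiv_unique nO bD (bounded_lin_comp bDtau bDphi) h2 h1) /=.
rewrite -(fderiv_jac nphi bDphi.1 hDphi).
have -> : jac phi (tau u) *m Dtau v =
    linfun (mulmx (jac phi (tau u)) : 'cV[R]_d -> 'cV[R]_n) (Dtau v).
  by rewrite lfunE.
exact/memv_img/memvf.
Qed.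

Lemma pi_inj k c (q q' : 'cV[R]_(k + k + c)) :
  pi_xz q = pi_xz q' -> pi_y q = pi_y q' -> q = q'.
Proof.
rewrite /pi_xz /pi_y => /eq_col_mx[e1 e2] e3.
rewrite -[q]vsubmxK -[q']vsubmxK -[usubmx q]vsubmxK -[usubmx q']vsubmxK.
by rewrite e1 e2 e3.
Qed.

Lemma pi_xz_linear k c : linear (@pi_xz R k c).
Proof.
by move=> a u v; rewrite /pi_xz !linearP /= -add_col_mx -scale_col_mx.
Qed.

Lemma pi_y_linear k c : linear (@pi_y R k c).
Proof. by move=> a u v; rewrite /pi_y !linearP. Qed.


Section Graphs.
Variables (k c : nat).
Notation n := (k + k + c)%N.
Variables (O : set 'cV[R]_n) (chi : 'cV[R]_n -> 'cV[R]_n).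
Hypothesis hchi : C2_coordinates O chi.
Variables (U : set 'cV[R]_k) (V : set 'cV[R]_c).
Hypotheses (oU : open U) (oV : open V).
Variables (x : 'cV[R]_k) (z : 'cV[R]_c).
Hypotheses (Ux : U x) (Vz : V z).

Let fkc : fin_dim ('cV[R]_k * 'cV[R]_c)%type.
Proof. by apply: fin_dim_prod; exact: fin_dim_cV. Qed.

Lemma C2_coordinates_inj : {in O &, injective chi}.
Proof.
have [_ _ _ [chi' _ chiK]] := hchi.
by move=> q q' /set_mem Oq /set_mem Oq' e; rewrite -(chiK q) // e chiK.
Qed.

(** By the chain rule for [chi' \o chi], which is the identity on O, the derivative of chi' is a
    left inverse of X. Injectivity allows equalities of vectors to be checked in coordinates. *)
Lemma C2_coordinates_derivative q : O q ->
  exists2 X, bounded_lin X /\ fderiv O chi q X & injective X.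
Proof.
have [oO Cchi oO' [chi' Cchi' chiK]] := hchi => Oq.
have [X [bX hX]] := Cr_fderiv (fin_dim_cV _) Oq Cchi.
have [Y [bY hY]] := Cr_fderiv (fin_dim_cV _) (ex_intro2 _ _ q Oq erefl) Cchi'.
exists X => //; apply: (can_inj (g := Y)) => v.
have bid : bounded_lin (@id 'cV[R]_n).
  by apply: fin_dim_bounded; first exact: fin_dim_cV.
have nO : nbhs q O by exact: open_nbhs_nbhs.
apply: (fderiv_unique (g := chi' \o chi) nO (bounded_lin_comp bX bY) bid).
  by apply: (fderiv_comp (T := chi @` O)) => // y Oy; exists y.
apply: (fderiv_eq (g := id)) => //; first by move=> y /chiK.
exact: fderiv_lin.
Qed.

(** D (F v) is the tangent vector of the piece that lies over v: differentiating the graph equation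
    shows that its (x, z) part in coordinates is v itself. *)
Lemma graph_derivative (psi : lparam (k + c) 'cV[R]_n)
    (f : 'cV[R]_k * 'cV[R]_c -> 'cV[R]_(k + c)) X :
  Cr 2 (ldom psi) psi -> Cr 2 (U `*` V) f ->
  (forall s, (U `*` V) s -> ldom psi (f s) /\ O (psi (f s))) ->
  (forall s, (U `*` V) s -> pi_xz (chi (psi (f s))) = col_mx s.1 s.2) ->
  bounded_lin X -> fderiv O chi (psi (f (x, z))) X ->
  exists D F, [/\ bounded_lin D /\ fderiv (ldom psi) psi (f (x, z)) D,
    linear F,
    forall v, pi_xz (X (D (F v))) = col_mx v.1 v.2 &
    fderiv (U `*` V) (fun s => chi (psi (f s))) (x, z) (fun v => X (D (F v)))].
Proof.
move=> Cpsi Cf dom xz bX hX.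
have UVxz : (U `*` V) (x, z) by [].
have [d1 d2] := dom _ UVxz.
have [F [bF hF]] := Cr_fderiv fkc UVxz Cf.
have [D [bD hD]] := Cr_fderiv (fin_dim_cV _) d1 Cpsi.
have h1 := fderiv_comp (fun s hs => (dom s hs).1) bF bD hF hD.
have bDF := bounded_lin_comp bF bD.
have h2 := fderiv_comp (fun s hs => (dom s hs).2) bDF bX h1 hX.
exists D, F; split => //; first exact: bF.1.
have bp : bounded_lin (@pi_xz R k c).
  by apply: fin_dim_bounded (fin_dim_cV _) _; exact: pi_xz_linear.
have bXDF := bounded_lin_comp bDF bX.
have h3 := fderiv_comp (T := setT) (fun _ _ => I) bXDF bp h2
  (fderiv_lin setT _ bp.1).
have nUV : nbhs (x, z) (U `*` V).
  by exists (U, V) => //; split; exact: open_nbhs_nbhs.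
have lc : linear (fun v : 'cV[R]_k * 'cV[R]_c => col_mx v.1 v.2).
  by move=> a u v; rewrite scale_col_mx add_col_mx.
have bc := fin_dim_bounded fkc lc.
apply: (fderiv_unique nUV (bounded_lin_comp bXDF bp) bc h3).
have h4 : fderiv (U `*` V) (fun v => col_mx v.1 v.2) (x, z)
    (fun v => col_mx v.1 v.2) by exact: fderiv_lin.
exact: (fderiv_eq (fun s hs => esym (xz s hs)) UVxz h4).
Qed.

Lemma transversal_of_graphs (W1 W2 : set 'cV[R]_n)
    (A1 A2 : set (lparam (k + c) 'cV[R]_n))
    (psi1 psi2 : lparam (k + c) 'cV[R]_n)
    (f1 f2 : 'cV[R]_k * 'cV[R]_c -> 'cV[R]_(k + c)) :
  C2_submanifold W1 A1 -> C2_submanifold W2 A2 ->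
  parameterises_piece W1 A1 psi1 -> parameterises_piece W2 A2 psi2 ->
  Cr 2 (ldom psi1) psi1 -> Cr 2 (ldom psi2) psi2 ->
  Cr 2 (U `*` V) f1 -> Cr 2 (U `*` V) f2 ->
  (forall s, (U `*` V) s -> ldom psi1 (f1 s) /\ O (psi1 (f1 s))) ->
  (forall s, (U `*` V) s -> ldom psi2 (f2 s) /\ O (psi2 (f2 s))) ->
  (forall s, (U `*` V) s -> pi_xz (chi (psi1 (f1 s))) = col_mx s.1 s.2) ->
  (forall s, (U `*` V) s -> pi_xz (chi (psi2 (f2 s))) = col_mx s.1 s.2) ->
  pi_y (chi (psi1 (f1 (x, z)))) = pi_y (chi (psi2 (f2 (x, z)))) ->
  (forall L v, linear L ->
    fderiv U (fun x => pi_y (chi (psi1 (f1 (x, z))))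
                       - pi_y (chi (psi2 (f2 (x, z))))) x L ->
    L v = 0 -> v = 0) ->
  intersect_transversally W1 A1 W2 A2.
Proof.
move=> sub1 sub2 par1 par2 C1 C2 Cf1 Cf2 dom1 dom2 xz1 xz2 y12 inj.
have UVxz : (U `*` V) (x, z) by [].
have [d1 o1] := dom1 _ UVxz; have [d2 o2] := dom2 _ UVxz.
have q12 : psi1 (f1 (x, z)) = psi2 (f2 (x, z)).
  apply: C2_coordinates_inj; rewrite ?inE//; apply: pi_inj => //.
  by rewrite xz1// xz2.
(* Both pieces pass through the same point, so a single derivative X of chi serves both. *)
have [X [bX hX] Xinj] := C2_coordinates_derivative o1.
have hX2 : fderiv O chi (psi2 (f2 (x, z))) X by rewrite -q12.
have [D1 [F1 [[bD1 hD1] lF1 xzF1 hF1]]] :=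
  graph_derivative C1 Cf1 dom1 xz1 bX hX.
have [D2 [F2 [[bD2 hD2] lF2 xzF2 hF2]]] :=
  graph_derivative C2 Cf2 dom2 xz2 bX hX2.
have [T1 tan1 inT1] := tangent_contains_image sub1 par1 d1 bD1 hD1.
have [T2 tan2 inT2] := tangent_contains_image sub2 par2 d2 bD2 hD2.
exists (psi1 (f1 (x, z))), T1, T2; split => //.
- by have [[_ _ h] _] := par1; apply: h; exists (f1 (x, z)).
- by rewrite q12; have [[_ _ h] _] := par2; apply: h; exists (f2 (x, z)).
- by rewrite q12.
have lX1 : linear (fun v => X (D1 (F1 v))).
  by move=> a u v; rewrite lF1 bD1.1 bX.1.
have lX2 : linear (fun v => X (D2 (F2 v))).
  by move=> a u v; rewrite lF2 bD2.1 bX.1.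
pose L (v : 'cV[R]_k) := pi_y (X (D1 (F1 (v, 0)))) - pi_y (X (D2 (F2 (v, 0)))).
have linl := @pair_inl_linear R 'cV[R]_k 'cV[R]_c.
have ly1 : linear (fun v : 'cV[R]_k => pi_y (X (D1 (F1 (v, 0))))).
  by move=> a u v; rewrite linl lX1 pi_y_linear.
have ly2 : linear (fun v : 'cV[R]_k => pi_y (X (D2 (F2 (v, 0))))).
  by move=> a u v; rewrite linl lX2 pi_y_linear.
have lL : linear L.
  by move=> a u v; rewrite /L ly1 ly2 scalerBr opprD addrACA.
(* L is a derivative at x of the difference occurring in [inj]: each graph derivative is restricted
   to constant z and projected by [pi_y]. *)
have Linj v : L v = 0 -> v = 0.
  apply: inj => //.
  have bpy : bounded_lin (@pi_y R k c).
    by apply: fin_dim_bounded (fin_dim_cV _) _; exact: pi_y_linear.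
  have slice (G : 'cV[R]_k * 'cV[R]_c -> 'cV[R]_n) DG :
      bounded_lin DG -> fderiv (U `*` V) G (x, z) DG ->
      fderiv U (fun x => pi_y (G (x, z))) x (fun v => pi_y (DG (v, 0))).
    move=> bG hG.
    have bl : bounded_lin (fun v : 'cV[R]_k => (v, 0 : 'cV[R]_c)).
      exact: fin_dim_bounded (fin_dim_cV _) linl.
    have hl : fderiv U (fun u : 'cV[R]_k => (u, z)) x (fun v => (v, 0)).
      by apply: fderiv_pair; [exact: fderiv_lin|exact: fderiv_cst].
    have dom u : U u -> (U `*` V) (u, z) by [].
    have h1 := fderiv_comp dom bl bG hl hG.
    exact: (fderiv_comp (T := setT) (fun _ _ => I) (bounded_lin_comp bl bG)
      bpy h1 (fderiv_lin setT _ bpy.1)).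
  have s1 := slice _ _ (fin_dim_bounded fkc lX1) hF1.
  have s2 := slice _ _ (fin_dim_bounded fkc lX2) hF2.
  have bN : bounded_lin (fun v : 'cV[R]_k => - v).
    by apply: fin_dim_bounded (fin_dim_cV _) _ => a u w; rewrite opprD scalerN.
  have by2 := fin_dim_bounded (fin_dim_cV _) ly2.
  have s2' := fderiv_comp (T := setT) (fun _ _ => I) by2 bN s2
    (fderiv_lin setT _ bN.1).
  exact: fderivD s1 s2'.
have Lsurj := injective_linear_surjective lL Linj.
apply/vspaceP => w; rewrite memvf.
pose xi := usubmx (pi_xz (X w)); pose zeta := dsubmx (pi_xz (X w)).
(* The first tangent vector over (xi, zeta) has the (x, z) part of w. Shifting it by kap in x and
   adding the second tangent vector over (-kap, 0) keeps this part and changes the y part by L kap,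
   chosen to be the missing amount. *)
have [kap hkap] := Lsurj (pi_y (X w) - pi_y (X (D1 (F1 (xi, zeta))))).
have -> : w = D1 (F1 (xi + kap, zeta)) + D2 (F2 (- kap, 0)).
  apply: Xinj; have XD u v : X (u + v) = X u + X v.
    by have := bX.1 1 u v; rewrite !scale1r.
  rewrite XD; apply: pi_inj.
    have xzD u v : @pi_xz R k c (u + v) = pi_xz u + pi_xz v.
      by have := @pi_xz_linear k c 1 u v; rewrite !scale1r.
    rewrite xzD xzF1 xzF2 /= add_col_mx addr0 addrK.
    by rewrite vsubmxK.
  have yD u v : @pi_y R k c (u + v) = pi_y u + pi_y v.
    by have := @pi_y_linear k c 1 u v; rewrite !scale1r.
  pose e1 : ('cV[R]_k * 'cV[R]_c)%type := (kap, 0).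
  have -> : (xi + kap, zeta) =
      1 *: e1 + ((xi, zeta) : ('cV[R]_k * 'cV[R]_c)%type).
    by rewrite scale1r [RHS]surjective_pairing /= addrC add0r.
  have -> : (- kap, 0) = -1 *: e1.
    by rewrite scaleN1r [RHS]surjective_pairing /= oppr0.
  rewrite yD lX1 (linZ (-1) e1 lX2) !(linZ _ _ (@pi_y_linear k c)) pi_y_linear.
  by rewrite scale1r scaleN1r addrAC -/(L kap) hkap subrK.
by apply: memv_add; [exact: inT1|exact: inT2].
Qed.

End Graphs.
End Geometry.

(** * Regularity of the graphs in (eps, x, z) and on slices, and the final assembly *)

Section Chart.
Context {R : realType}.

Lemma C2_in_coordinates d k c n (E : set R^o) (U : set 'cV[R]_k)
    (V : set 'cV[R]_c) (D : set 'cV[R]_d) (O : set 'cV[R]_n)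
    (chi : 'cV[R]_n -> 'cV[R]_n)
    (w : R -> 'cV[R]_d -> 'cV[R]_n)
    (f : R -> 'cV[R]_k -> 'cV[R]_c -> 'cV[R]_d) :
  Cr 2 (E `*` D) (fun p : R^o * 'cV[R]_d => w p.1 p.2) -> Cr 2 O chi ->
  Cr 2 (E `*` U `*` V)
    (fun p : R^o * 'cV[R]_k * 'cV[R]_c => f p.1.1 p.1.2 p.2) ->
  (forall e x z, E e -> U x -> V z -> D (f e x z) /\ O (w e (f e x z))) ->
  Cr 2 (E `*` U `*` V)
    (fun p : R^o * 'cV[R]_k * 'cV[R]_c => chi (w p.1.1 (f p.1.1 p.1.2 p.2))).
Proof.
move=> Cw Cchi Cf dom.
have f1 : fin_dim (R^o * 'cV[R]_k * 'cV[R]_c)%type.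
  apply: fin_dim_prod (fin_dim_cV _).
  exact: fin_dim_prod fin_dim_R (fin_dim_cV _).
have f2 : fin_dim (R^o * 'cV[R]_d)%type.
  exact: fin_dim_prod fin_dim_R (fin_dim_cV _).
have C1 : Cr 2 (E `*` U `*` V) (fun p : R^o * 'cV[R]_k * 'cV[R]_c => p.1.1).
  apply: Cr_lin.
  exact: bounded_lin_comp (@bounded_lin_fst R _ _) (@bounded_lin_fst R _ _).
have C2 := Cr_pair C1 Cf.
have d2 p : (E `*` U `*` V) p -> (E `*` D) (p.1.1, f p.1.1 p.1.2 p.2).
  by move=> [[/= Ep Up] Vp]; split=> //=; have [] := dom _ _ _ Ep Up Vp.
have C3 := Cr_comp f1 f2 d2 C2 Cw.
have d3 p : (E `*` U `*` V) p -> O (w p.1.1 (f p.1.1 p.1.2 p.2)).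
  by move=> [[/= Ep Up] Vp]; have [] := dom _ _ _ Ep Up Vp.
exact: (Cr_comp f1 (fin_dim_cV _) d3 C3 Cchi).
Qed.

Lemma Cr_slice_z r k c (W : normedModType R) (E : set R^o) (U : set 'cV[R]_k)
    (V : set 'cV[R]_c) (g : R^o * 'cV[R]_k * 'cV[R]_c -> W) z :
  V z -> Cr r (E `*` U `*` V) g ->
  Cr r (E `*` U) (fun p : R^o * 'cV[R]_k => g (p, z)).
Proof.
move=> Vz Cg.
have f1 : fin_dim (R^o * 'cV[R]_k)%type.
  exact: fin_dim_prod fin_dim_R (fin_dim_cV _).
have f2 : fin_dim (R^o * 'cV[R]_k * 'cV[R]_c)%type.
  exact: fin_dim_prod f1 (fin_dim_cV _).
have C1 : Cr r (E `*` U) (fun p : R^o * 'cV[R]_k => (p, z)).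
  apply: Cr_pair; last exact: Cr_cst.
  by apply: Cr_lin; exact: fin_dim_bounded f1 _.
have dom p : (E `*` U) p -> (E `*` U `*` V) (p, z) by [].
exact: (Cr_comp f1 f2 dom C1 Cg).
Qed.

Lemma Cr_slice_xz r k c (W : normedModType R) (E : set R^o) (U : set 'cV[R]_k)
    (V : set 'cV[R]_c) (g : R^o * 'cV[R]_k * 'cV[R]_c -> W) (e : R^o) :
  E e -> Cr r (E `*` U `*` V) g ->
  Cr r (U `*` V) (fun s : 'cV[R]_k * 'cV[R]_c => g (e, s.1, s.2)).
Proof.
move=> Ee Cg.
have f1 : fin_dim ('cV[R]_k * 'cV[R]_c)%type.
  exact: fin_dim_prod (fin_dim_cV _) (fin_dim_cV _).
have f2 : fin_dim (R^o * 'cV[R]_k * 'cV[R]_c)%type.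
  apply: fin_dim_prod (fin_dim_cV _).
  exact: fin_dim_prod fin_dim_R (fin_dim_cV _).
have C1 : Cr r (U `*` V) (fun s : 'cV[R]_k * 'cV[R]_c => (e, s.1, s.2)).
  apply: Cr_pair; first apply: Cr_pair; first exact: Cr_cst.
    by apply: Cr_lin; exact: bounded_lin_fst.
  by apply: Cr_lin; exact: bounded_lin_snd.
have dom s : (U `*` V) s -> (E `*` U `*` V) (e, s.1, s.2) by move=> [].
exact: (Cr_comp f1 f2 dom C1 Cg).
Qed.

Lemma Cr_slice_right r d (W : normedModType R) (E : set R^o) (D : set 'cV[R]_d)
    (g : R^o * 'cV[R]_d -> W) (e : R^o) :
  E e -> Cr r (E `*` D) g -> Cr r D (fun v => g (e, v)).
Proof.
move=> Ee Cg.
have f2 : fin_dim (R^o * 'cV[R]_d)%type.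
  exact: fin_dim_prod fin_dim_R (fin_dim_cV _).
have C1 : Cr r D (fun v : 'cV[R]_d => (e, v)).
  apply: Cr_pair; first exact: Cr_cst.
  by apply: Cr_lin; exact: fin_dim_bounded (fin_dim_cV _) _.
have dom v : D v -> (E `*` D) (e, v) by [].
exact: (Cr_comp (fin_dim_cV _) f2 dom C1 Cg).
Qed.

End Chart.

Theorem theorem13 (R : realType) (k1 k2 c : nat) :
  let k := (k1 + k2)%N in
  let n := (k + k + c)%N in
  c <> 0%N ->
  forall (e0 : R), 0 < e0 ->
  let E : set R := `[0, e0]%classic in
  forall (f : R -> 'cV[R]_n -> 'cV[R]_n) (Phi : R -> R -> 'cV[R]_n -> 'cV[R]_n),
  smooth ((E : set R^o) `*` [set: 'cV[R]_n])
    (fun p : R^o * 'cV[R]_n => f p.1 p.2) ->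
  (forall e, E e -> is_flow (f e) (Phi e)) ->
  (* Lambda is the abstract manifold M, and Lambda_eps the image of M by h eps *)
  forall (M : Type) (AM : set (lparam c M)) (h : R -> M -> 'cV[R]_n),
  C2_manifold [set: M] AM ->
  (forall e, E e -> injective (h e)) ->
  let L (e : R) := range (h e) in
  let AL (e : R) := push_atlas (h e) AM in
  (forall e, E e -> nhim k (Phi e) (L e) (AL e)) ->
  let Wu (e : R) := Wcu (Phi e) (L e) in
  let Ws (e : R) := Wcs (Phi e) (L e) in
  forall (Au As : R -> set (lparam (k + c) 'cV[R]_n)),
  (forall e, E e -> C2_submanifold (Wu e) (Au e)) ->
  (forall e, E e -> C2_submanifold (Ws e) (As e)) ->
  forall wu ws : R -> 'cV[R]_k -> M -> 'cV[R]_n,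
  C2_parameterisation E AM Wu Au wu ->
  C2_parameterisation E AM Ws As ws ->
  (* local coordinates, and charts of Lambda in which the parameters are read *)
  forall (O : set 'cV[R]_n) (chi : 'cV[R]_n -> 'cV[R]_n),
  C2_coordinates O chi ->
  forall kappau kappas : lparam c M, AM kappau -> AM kappas ->
  let wu' (e : R) := in_chart (wu e) kappau in
  let ws' (e : R) := in_chart (ws e) kappas in
  forall U' S' : set 'cV[R]_(k + c),
  xz_invertible E O chi wu' U' ->
  xz_invertible E O chi ws' S' ->
  forall (U : set 'cV[R]_k) (V : set 'cV[R]_c), open U -> open V ->
  (forall x z, U x -> V z ->
     (xz_image E chi wu' U' `&` xz_image E chi ws' S') (col_mx x z)) ->
  forall cu cs : R -> 'cV[R]_k -> 'cV[R]_c -> 'cV[R]_(k + c),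
  Cr 2 ((E : set R^o) `*` U `*` V)
    (fun p : R^o * 'cV[R]_k * 'cV[R]_c => cu p.1.1 p.1.2 p.2) ->
  Cr 2 ((E : set R^o) `*` U `*` V)
    (fun p : R^o * 'cV[R]_k * 'cV[R]_c => cs p.1.1 p.1.2 p.2) ->
  (forall e x z, E e -> U x -> V z ->
     U' (cu e x z) /\ pi_xz (chi (wu' e (cu e x z))) = col_mx x z) ->
  (forall e x z, E e -> U x -> V z ->
     S' (cs e x z) /\ pi_xz (chi (ws' e (cs e x z))) = col_mx x z) ->
  forall (zstar : 'cV[R]_c), V zstar ->
  forall y : R -> 'cV[R]_k -> 'cV[R]_k,
  (forall e x, E e -> U x ->
     y e x = pi_y (chi (wu' e (cu e x zstar)))
             - pi_y (chi (ws' e (cs e x zstar)))) ->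
  let y1 (e : R) (x : 'cV[R]_k) : 'cV[R]_k1 := usubmx (y e x) in
  let y2 (e : R) (x : 'cV[R]_k) : 'cV[R]_k2 := dsubmx (y e x) in
  forall (N1 : 'cV[R]_k1 -> R) (N2 : 'cV[R]_k2 -> R),
  is_norm N1 -> is_norm N2 ->
  let N := max_norm N1 N2 in
  forall (p : 'cV[R]_k) (r : R), 0 < r ->
  U = [set x | N (x - p) < r] ->
  y 0 p = 0 ->
  (forall x, U x -> y2 0 x = 0) ->
  let dy1dx (e : R) (x : 'cV[R]_k) : 'M[R]_(k1, k) := jac (y1 e) x in
  let d2y2dedx (e : R) (x : 'cV[R]_k) : 'M[R]_(k2, k) :=
    derive_in E (fun s => jac (y2 s) x) e in
  let A11 : 'M[R]_k1 := lsubmx (dy1dx 0 p) in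
  let A22 : 'M[R]_k2 := rsubmx (d2y2dedx 0 p) in
  forall (lo1 hi1 : 'M[R]_(k1, k)) (lo2 hi2 : 'M[R]_(k2, k)),
  encloses lo1 hi1
    [set D | exists e x, [/\ E e, U x & D = dy1dx e x - row_mx A11 0]] ->
  encloses lo2 hi2
    [set D | exists e x, [/\ E e, U x & D = d2y2dedx e x - row_mx 0 A22]] ->
  let Delta1 := interval_mx lo1 hi1 in
  let Delta2 := interval_mx lo2 hi2 in
  ((0 < k1)%N ->
     e0 * set_norm N1 [set derive_in E (fun s => y1 s p) e | e in E]
     + set_norm (op_norm N N1) Delta1 * r < co_norm N1 A11 * r) ->
  ((0 < k2)%N ->
     set_norm N2 [set derive_in E (fun s => y2 s p) e | e in E]
     + set_norm (op_norm N N2) Delta2 * r < co_norm N2 A22 * r) ->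
  forall e, 0 < e <= e0 ->
    intersect_transversally (Wu e) (Au e) (Ws e) (As e).
Proof.
move=> k n _ e0 e00 E f Phi _ _ M AM h _ _ L AL _ Wu Ws Au As subu subs wu ws.
move=> paru pars O chi hchi kappau kappas Aku Aks wu' ws' U' S' xzu xzs.
move=> U V oU oV _ cu cs Cu Cs hu hs zstar Vz y yE y1 y2 N1 N2 h1 h2 N p r r0.
move=> UE y0 y20 dy1dx d2y2dedx A11 A22 lo1 hi1 lo2 hi2 enc1 enc2 D1 D2 in1 in2.
move=> e eb.
have Ee : E e.
  by case/andP: eb => e1 e2; rewrite /E /= in_itv /= (ltW e1).
have [_ _ domu _] := xzu; have [_ _ doms _] := xzs.
have [Cwu pu] := paru _ Aku; have [Cws ps] := pars _ Aks.
have [_ Cchi _ _] := hchi.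
(* The parameter domain of [in_chart] is the same for all eps, so w is C^2 on a genuine product E x
   Dom, as the composition lemmas require. *)
pose Dom (kap : lparam c M) : set 'cV[R]_(k + c) :=
  [set v | unit_ball (usubmx v) /\ ldom kap (dsubmx v)].
have du s x z : E s -> U x -> V z ->
    Dom kappau (cu s x z) /\ O (wu' s (cu s x z)).
  by move=> Es Ux Vz'; have [Uc _] := hu _ _ _ Es Ux Vz'; exact: domu Es _ Uc.
have ds s x z : E s -> U x -> V z ->
    Dom kappas (cs s x z) /\ O (ws' s (cs s x z)).
  by move=> Es Ux Vz'; have [Sc _] := hs _ _ _ Es Ux Vz'; exact: doms Es _ Sc.
have Fu := @C2_in_coordinates R (k + c) k c n E U V (Dom kappau) O chi
  (fun s => wu' s) cu Cwu Cchi Cu du.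
have Fs := @C2_in_coordinates R (k + c) k c n E U V (Dom kappas) O chi
  (fun s => ws' s) cs Cws Cchi Cs ds.
have fRU : fin_dim (R^o * 'cV[R]_k)%type.
  exact: fin_dim_prod fin_dim_R (fin_dim_cV _).
have bpy : bounded_lin (@pi_y R k c).
  by apply: fin_dim_bounded (fin_dim_cV _) _; exact: pi_y_linear.
have Yu := Cr_linc fRU bpy (Cr_slice_z Vz Fu).
have Ys := Cr_linc fRU bpy (Cr_slice_z Vz Fs).
have hy : Cr 2 ((E : set R^o) `*` U) (fun q : R^o * 'cV[R]_k => y q.1 q.2).
  have q := CrD Yu (CrN fRU Ys).
  apply: (Cr_eq _ _ q) => //.
  by move=> [s x] /set_mem[/= Es Ux]; rewrite yE.
have [x [Ux yx0 inj]] : exists x, [/\ U x, y e x = 0 &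
    forall L v, linear L -> fderiv U (y e) x L -> L v = 0 -> v = 0].
  (* The zero is sought in the explicit ball of radius r about p. *)
  rewrite UE in oU hy enc1 enc2 y20 *.
  exact: (transversal_zero h1 h2 e00 r0 oU hy y0 y20 enc1 enc2 in1 in2 eb).
have Cpu := @Cr_slice_right R 2 (k + c) _ E (Dom kappau) _ e Ee Cwu.
have Cps := @Cr_slice_right R 2 (k + c) _ E (Dom kappas) _ e Ee Cws.
have Cfu := @Cr_slice_xz R 2 k c _ E U V _ e Ee Cu.
have Cfs := @Cr_slice_xz R 2 k c _ E U V _ e Ee Cs.
apply: (@transversal_of_graphs R k c O chi hchi U V oU oV x zstar Ux Vz
  (Wu e) (Ws e) (Au e) (As e) (wu' e) (ws' e)
  (fun s => cu e s.1 s.2) (fun s => cs e s.1 s.2)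
  (subu e Ee) (subs e Ee) (pu e Ee) (ps e Ee) Cpu Cps Cfu Cfs).
- by move=> [x' z'] [/= Ux' Vz']; exact: du.
- by move=> [x' z'] [/= Ux' Vz']; exact: ds.
- by move=> [x' z'] [/= Ux' Vz']; have [] := hu _ _ _ Ee Ux' Vz'.
- by move=> [x' z'] [/= Ux' Vz']; have [] := hs _ _ _ Ee Ux' Vz'.
- by apply/eqP; rewrite -subr_eq0 -yE// yx0.
(* y e equals the difference of the two graphs on U, so a derivative of one is a derivative of the
   other. *)
move=> L' v lL hL; apply: inj => //.
by apply: fderiv_eq hL => // x' Ux'; rewrite yE.
Qed.
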